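(* Let $n\ge 2$ and let $a,b$ be nonnegative integers. Let $K_{n+1}^{a,b}$ be the directed multigraph on vertex set $[n+1]$ in which each edge $(i,j)$, $1\le i<j\le n$, appears with multiplicity $a$ and each edge $(i,n+1)$, $i\in[n]$, appears with multiplicity $b$. Then \[ \operatorname{vol}\mathcal{F}_{K_{n+1}^{a,b}}(1,1,\ldots,1,-n)=\Big((b-1)n+a\tbinom n2\Big)!\prod_{i=0}^{n-1}\frac{\Gamma(1+a/2)}{\Gamma(1+(i+1)a/2)\,\Gamma(b+ia/2)}. \]
   Context: For a directed multigraph $G$ on vertex set $[n+1]$ whose $N$ edges are of the form $(i,j)$ with $i<j$ (edges may be repeated, each copy giving its own coordinate), and an integer vector $\mathbf a=(a_1,\dots,a_{n+1})$ with $a_{n+1}=-\sum_{i=1}^n a_i$, the flow polytope $\mathcal{F}_G(\mathbf a)\subset\mathbb{R}^N$ is the set of $(f_e)_{e\in E(G)}$ with all $f_e\ge0$ such that for every vertex $i$, $\sum_{e=(g,i)} f_e+a_i=\sum_{e=(i,j)} f_e$. The normalized volume $\operatorname{vol}$ of a $d$-dimensional polytope $P\subset\mathbb{R}^N$ is the volume form on the affine span of $P$ assigning volume $1$ to the smallest $d$-dimensional integer simplex in that affine span. $\Gamma$ is the Gamma function. *)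

(* Defs.v *)
From HB Require Import structures.
From mathcomp Require Import all_boot all_order all_algebra.
From mathcomp Require Import all_classical all_reals all_analysis.

Set Implicit Arguments.
Unset Strict Implicit.
Unset Printing Implicit Defensive.

Import Order.TTheory GRing.Theory Num.Theory.
Import numFieldNormedType.Exports.

Local Open Scope classical_set_scope.
Local Open Scope ring_scope.

(* Directed multigraphs on the vertex set 'I_m: the sequence lists every copy  *)
(* of every edge, so that edges are indexed by 'I_(size (edges G)).            *)
Record multigraph (m : nat) := Multigraph {
  edges : seq ('I_m * 'I_m);
  edges_increasing : all (fun e : 'I_m * 'I_m => (e.1 < e.2)%N) edges
}.

Definition nb_edges m (G : multigraph m) : nat := size (edges G).

Definition edge m (G : multigraph m) (e : 'I_(nb_edges G)) : 'I_m * 'I_m :=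
  tnth (in_tuple (edges G)) e.

Definition flow_polytope (R : realType) m (G : multigraph m) (a : 'I_m -> int) :
    set 'rV[R]_(nb_edges G) :=
  [set f | (forall e, 0 <= f ord0 e) /\
           (forall i : 'I_m,
              \sum_(e | (edge e).2 == i) f ord0 e + (a i)%:~R =
              \sum_(e | (edge e).1 == i) f ord0 e)].

(* The vertices 1, ..., n+1 are the elements of 'I_n.+1; n+1 is ord_max.       *)
Definition Kab_edges (n a b : nat) : seq ('I_n.+1 * 'I_n.+1) :=
  flatten [seq nseq (if e.2 == ord_max then b else a) e
          | e <- [seq e : 'I_n.+1 * 'I_n.+1 <- enum {: 'I_n.+1 * 'I_n.+1} | (e.1 < e.2)%N]].

Lemma Kab_edges_increasing n a b :
  all (fun e : 'I_n.+1 * 'I_n.+1 => (e.1 < e.2)%N) (Kab_edges n a b).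
Proof.
apply/allP => e /flattenP[s /mapP[e' + ->]].
by rewrite mem_filter => /andP[lt_e' _]; rewrite mem_nseq => /andP[_ /eqP->].
Qed.

Definition Kab (n a b : nat) : multigraph n.+1 :=
  Multigraph (Kab_edges_increasing n a b).

Definition netflow_ones (n : nat) (i : 'I_n.+1) : int :=
  if i == ord_max then - n%:Z else 1.

Definition affine_span (R : realType) N (P : set 'rV[R]_N) : set 'rV[R]_N :=
  [set x | exists (k : nat) (c : 'I_k -> R) (p : 'I_k -> 'rV[R]_N),
     [/\ forall i, P (p i), \sum_i c i = 1 & x = \sum_i c i *: p i]].

(* A (possibly degenerate) d-simplex is given by its d+1 vertices.             *)
Definition edge_mx (R : realType) d N (v : 'I_d.+1 -> 'rV[R]_N) : 'M[R]_(d, N) :=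
  \matrix_(i < d) (v (lift ord0 i) - v ord0).

Definition affinely_independent (R : realType) d N
    (v : 'I_d.+1 -> 'rV[R]_N) : Prop :=
  row_free (edge_mx v).

(* P has dimension d; no d : nat qualifies when P is empty.                    *)
Definition has_dim (R : realType) N (P : set 'rV[R]_N) (d : nat) : Prop :=
  exists v : 'I_d.+1 -> 'rV[R]_N,
    affinely_independent v /\ affine_span (range v) = affine_span P.

(* The d-dimensional Euclidean volume, given by the Gram determinant.          *)
Definition simplex_volume (R : realType) d N (v : 'I_d.+1 -> 'rV[R]_N) : R :=
  Num.sqrt (\det (edge_mx v *m (edge_mx v)^T)) / (d`!)%:R.

Definition integer_simplex (R : realType) N (A : set 'rV[R]_N) d
    (v : 'I_d.+1 -> 'rV[R]_N) : Prop :=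
  [/\ affinely_independent v,
      forall i, A (v i) &
      forall i j, v i ord0 j \is a Num.int].

Definition smallest_integer_simplex (R : realType) N (A : set 'rV[R]_N) d
    (v : 'I_d.+1 -> 'rV[R]_N) : Prop :=
  integer_simplex A v /\
  forall w : 'I_d.+1 -> 'rV[R]_N,
    integer_simplex A w -> simplex_volume v <= simplex_volume w.

(* Lebesgue measure on R^d: the iterated product of lebesgue_measure, computed *)
(* by slicing exactly as in product_measure1.                                  *)
Fixpoint lebesgue_rV (R : realType) (d : nat) : set 'rV[R]_d -> \bar R :=
  match d with
  | 0 => fun A => (\1_A 0)%:E
  | d'.+1 => fun A : set 'rV[R]_(1 + d') =>
      (\int[@lebesgue_measure R]_x
         lebesgue_rV [set y : 'rV[R]_d' | A (row_mx x%:M y)])%E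
  end.

Definition simplex_chart (R : realType) d N (v : 'I_d.+1 -> 'rV[R]_N)
    (t : 'rV[R]_d) : 'rV[R]_N :=
  v ord0 + t *m edge_mx v.

(* The affine coordinates simplex_chart v send the standard simplex of R^d,    *)
(* of Lebesgue measure 1/d!, to the simplex v; hence the factor d! gives       *)
(* volume 1 to v. All choices of d and of a smallest v yield the same value.   *)
(* The default value 0 is reached by the empty set.                            *)
Definition normalized_volume (R : realType) N (P : set 'rV[R]_N) : \bar R :=
  xget 0%E [set x : \bar R | exists (d : nat) (v : 'I_d.+1 -> 'rV[R]_N),
    [/\ has_dim P d,
        smallest_integer_simplex (affine_span P) v &
        x = ((d`!)%:R%:E * lebesgue_rV (simplex_chart v @^-1` P))%E]].

(* Euler's integral, for x > 0. At the pole x = 0 the integral is +oo, so that *)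
(* Gamma 0 = fine +oo = 0 and, inverses being total, (Gamma 0)^-1 = 0, which   *)
(* is the value at 0 of the entire function 1/Gamma.                           *)
Definition Gamma (R : realType) (x : R) : R :=
  fine (\int[@lebesgue_measure R]_(t in `]0%R, +oo[)
          (t `^ (x - 1) * expR (- t))%:E)%E.

(* Main.v *)
Require Import Defs.
From mathcomp Require Import all_boot all_order all_algebra.
From mathcomp Require Import all_classical all_reals all_analysis.
From mathcomp Require Import measurable_realfun ring lra zify.

(* Eliminating the flow on one sink edge of each vertex and integrating over   *)
(* the other edges one at a time, the volume is d! V, where V is the           *)
(* multivariate spline (truncated power) of the remaining edge vectors at      *)
(* (1, ..., 1). Two relations between the numbers V for various                *)
(* multiplicities suffice to compute it. Integrating the conservation of flow  *)
(* at a vertex gives a linear relation, since integrating the flow of an edge  *)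
(* amounts to doubling that edge. Cutting a two-dimensional cone along the sum *)
(* of its generators expresses i -> j -> n+1 through i -> n+1. If E_u is the   *)
(* sum of V over the sets of u vertices that have b sink edges, the other      *)
(* vertices having b - 1, these relations give Aomoto's recursion              *)
(*   (n - u) E_u = (u + 1) (b - 1 + a u / 2) E_(u+1),                          *)
(* which relates b - 1 to b. When b = 1, the last vertex has a single outgoing *)
(* edge, whose contraction lowers n by one and changes b into 1 + a. The       *)
(* product of Gamma values satisfies the same recurrences. Finally, any two    *)
(* smallest integer simplices differ by a linear map of determinant 1 or -1,   *)
(* so that the normalized volume can be computed in the chart above.           *)

(** Three strands meet in [theorem1p3]. Geometry: one sink edge per vertex forms a spanning tree,
    and the fundamental cycles of the remaining edges give an integral chart of the space of flows
    with an identity block. The tree simplex is therefore a smallest one, and the normalized volume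
    is a factorial times an iterated integral ([smallest_integer_simplexI],
    [normalized_volume_chart], [normalized_volume_tree]). Combinatorics: these integrals obey
    conservation ([rspline_balance]) and subdivision ([spline_subdivide]). When conservation at [k]
    is summed over all pairs of a set [U] and a vertex [k] outside [U], the terms of an inner edge
    combine into exactly the differences that subdivision evaluates ([elementary_volume_rec]).
    Chaining from the empty set to the full one changes the sink multiplicity by one at every vertex
    ([flow_volume_sink_step]); contraction ([flow_volume_contract]) gives the starting value.
    Arithmetic: the Gamma product obeys the same two rules, by the functional equation
    ([gamma_productS]) and by telescoping ([gamma_product_contract]). Since both sides are 1 for
    [n = 0], they agree ([flow_volumeE]). *)

Set Implicit Arguments.
Unset Strict Implicit.
Unset Printing Implicit Defensive.

Import Order.TTheory GRing.Theory Num.Theory.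
Import numFieldNormedType.Exports.

Local Open Scope classical_set_scope.
Local Open Scope ring_scope.

(** * Lebesgue integrals on the line *)

Section OneDim.
Context (R : realType).
Local Notation mu := (@lebesgue_measure R).
Local Open Scope ereal_scope.

Lemma ge0_integral_shift (F : R -> \bar R) (r : R) :
  measurable_fun [set: R] F -> (forall t, 0 <= F t) ->
  \int[mu]_t F (t + r)%R = \int[mu]_t F t.
Proof.
move=> mF F0.
pose phi (t : measurableTypeR R) : measurableTypeR R := (t + r)%R.
have mphi : measurable_fun setT phi by apply: measurable_funD.
rewrite [LHS](_ : _ = \int[pushforward mu phi]_y F y); last first.
  by rewrite ge0_integral_pushforward//= preimage_setT.
apply: eq_measure_integral => A mA _.
apply/esym/lebesgue_measure_unique => //= _ [[a b]] _ <-.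
rewrite /pushforward/= (_ : phi @^-1` _ = `](a - r)%R, (b - r)%R]%classic).
  rewrite !lebesgue_measure_itv/= !lte_fin ltrD2r.
  by case: ifP => // _; rewrite -!EFinB; congr EFin; ring.
by apply/seteqP; split => t; rewrite /phi /= !in_itv/= ltrBlDr lerBrDr.
Qed.

(** [|a|] times the image measure agrees with Lebesgue measure on half-open intervals. For [a < 0]
    the preimage is closed at the other end, which leaves its length unchanged. *)
Lemma ge0_integral_scale (F : R -> \bar R) (a : R) : a != 0%R ->
  measurable_fun [set: R] F -> (forall t, 0 <= F t) ->
  \int[mu]_t F (t * a)%R = (`|a|^-1)%:E * \int[mu]_t F t.
Proof.
move=> a0 mF F0.
pose phi (t : measurableTypeR R) : measurableTypeR R := (t * a)%R.
have mphi : measurable_fun setT phi by apply: measurable_funM.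
have -> : \int[mu]_t F (t * a)%R = \int[pushforward mu phi]_y F y.
  by rewrite ge0_integral_pushforward//= preimage_setT.
have k0 : (0 <= `|a|)%R by [].
have -> : \int[mu]_t F t = `|a|%:E * \int[pushforward mu phi]_y F y.
  rewrite -[in RHS](ge0_integral_mscale (pushforward mu phi) measurableT
    (NngNum k0))//.
  apply: eq_measure_integral => A mA _.
  apply: lebesgue_measure_unique => //= _ [[x y]] _ <-.
  rewrite /mscale /= /pushforward/=.
  have [a_gt0|] := ltP 0%R a.
    rewrite (_ : phi @^-1` _ = `](x / a)%R, (y / a)%R]%classic).
      rewrite !lebesgue_measure_itv/= !lte_fin ltr_pM2r ?invr_gt0//.
      case: ifP => [_|]; last by rewrite mule0.
      rewrite -!EFinB -EFinM gtr0_norm//; congr EFin.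
      by field; rewrite gt_eqF.
    apply/seteqP; split => t; rewrite /phi /= !in_itv/=.
      by rewrite ltr_pdivrMr// ler_pdivlMr.
    by rewrite ltr_pdivrMr// ler_pdivlMr.
  rewrite le_eqVlt (negbTE a0)/= => a_lt0.
  rewrite (_ : phi @^-1` _ = `[(y / a)%R, (x / a)%R[%classic).
    rewrite !lebesgue_measure_itv/= !lte_fin ltr_nM2r ?invr_lt0//.
    case: ifP => [_|]; last by rewrite mule0.
    rewrite -!EFinB -EFinM ltr0_norm//; congr EFin.
    by field; rewrite lt_eqF.
  apply/seteqP; split => t; rewrite /phi /= !in_itv/=.
    by rewrite ltr_ndivlMr// ler_ndivrMr// andbC.
  by rewrite ltr_ndivlMr// ler_ndivrMr// andbC.
by rewrite muleA -EFinM mulVf ?normr_eq0// mul1e.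
Qed.

End OneDim.

Lemma tonelli_lebesgue (R : realType) (f : R -> R -> \bar R) :
  measurable_fun [set: R * R] (fun z => f z.1 z.2) ->
  (forall x y, (0 <= f x y)%E) ->
  (\int[@lebesgue_measure R]_x \int[@lebesgue_measure R]_y f x y =
   \int[@lebesgue_measure R]_y \int[@lebesgue_measure R]_x f x y)%E.
Proof.
move=> mf f0.
exact: (@fubini_tonelli _ _ _ _ _ (@lebesgue_measure R) (@lebesgue_measure R) _ mf (fun z => f0 z.1 z.2)).
Qed.

Lemma measurable_integral_lebesgue (R : realType) d (T : measurableType d)
    (f : T -> R -> \bar R) :
  measurable_fun [set: T * R] (fun z => f z.1 z.2) ->
  (forall x y, (0 <= f x y)%E) ->
  measurable_fun [set: T] (fun x => \int[@lebesgue_measure R]_y f x y)%E.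
Proof.
move=> mf f0.
exact: (@measurable_fun_fubini_tonelli_F _ _ _ _ _ (@lebesgue_measure R) _ mf (fun z => f0 z.1 z.2)).
Qed.

(** * Splines of edge vectors *)

Section Spline.
Context (R : realType).
Local Notation mu := (@lebesgue_measure R).
Implicit Types (s : nat -> R) (e : nat * nat) (X : seq (nat * nat)).

Definition edge_col e k : R := (k == e.1)%:R - (k == e.2)%:R.

(** The supplies left once a flow [t] has been sent along [e]; [edge_col e] is the column of [e] in
    the incidence matrix. *)
Definition push_flow s (t : R) e k : R := s k - t * edge_col e k.

(* The volume of the set of nonnegative flows on the edges X with supplies s,
   the sink being n, in the graph that has in addition one edge (i, n) for each
   vertex i < n: the flow on the latter edges is determined by the others and
   only its sign is tested. *)
Fixpoint spline n X s : \bar R :=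
  if X is e :: X' then
    (\int[mu]_t (if (0 <= t)%R then spline n X' (push_flow s t e) else 0))%E
  else (all (fun k => 0 <= s k) (iota 0 n))%:R%:E.

Local Open Scope ereal_scope.

Lemma spline_ge0 n X s : 0 <= spline n X s.
Proof.
elim: X s => [|e X IH] s /=; first by rewrite lee_fin ler0n.
by apply: integral_ge0 => t _; case: ifP.
Qed.

Lemma eq_spline n X s s' : (forall k, (k < n)%N -> s k = s' k) ->
  spline n X s = spline n X s'.
Proof.
elim: X s s' => [|e X IH] s s' ss' /=.
  congr (_%:R%:E); congr (nat_of_bool _); apply: eq_in_all => k.
  by rewrite mem_iota /= add0n => /ss' ->.
apply: eq_integral => t _; case: ifP => // _.
by apply: IH => k kn; rewrite /push_flow ss'.
Qed.

Lemma measurable_spline n X d (T : measurableType d) (g : T -> nat -> R) :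
  (forall k, measurable_fun setT (g^~ k)) ->
  measurable_fun [set: T] (fun x => spline n X (g x)).
Proof.
elim: X d T g => [|e X IH] d T g mg /=.
  apply/measurable_EFinP.
  apply: (@measurableT_comp _ _ _ _ _ _ (fun b : bool => b%:R : R)) => //.
  elim: (iota 0 n) => [|k l IHl] /=; first exact: measurable_cst.
  by apply: measurable_and => //; exact: measurable_fun_ler.
apply: measurable_integral_lebesgue.
  apply: measurable_fun_ifT; first exact: measurable_fun_ler.
    apply: IH => k; apply: measurable_funB.
      exact: (measurableT_comp (mg k)).
    exact: measurable_funM.
  exact: measurable_cst.
by move=> x t; case: ifP => // _; exact: spline_ge0.
Qed.

Lemma measurable_push_flow n X s e :
  measurable_fun [set: R] (fun t => spline n X (push_flow s t e)).
Proof.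
apply: measurable_spline => k; apply: measurable_funB => //.
exact: measurable_funM.
Qed.

Lemma spline_cons2 n X e e' s : spline n [:: e, e' & X] s =
  \int[mu]_t \int[mu]_u (if ((0 <= t) && (0 <= u))%R then
     spline n X (push_flow (push_flow s t e) u e') else 0).
Proof.
apply: eq_integral => t _; case: ifP => t0 //=.
by rewrite integral0_eq.
Qed.

Lemma push_flowC s t u e e' :
  push_flow (push_flow s t e) u e' = push_flow (push_flow s u e') t e.
Proof. by apply/funext => k; rewrite /push_flow; ring. Qed.

Lemma spline_swap n X e e' s : spline n [:: e, e' & X] s = spline n [:: e', e & X] s.
Proof.
rewrite !spline_cons2.
rewrite tonelli_lebesgue.
- apply: eq_integral => u _; apply: eq_integral => t _.
  by rewrite andbC push_flowC.
- apply: measurable_fun_ifT => //.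
    by apply: measurable_and; exact: measurable_fun_ler.
  apply: measurable_spline => k; rewrite /push_flow; apply: measurable_funB.
    by apply: measurable_funB => //; exact: measurable_funM.
  exact: measurable_funM.
- by move=> t u; case: ifP => // _; exact: spline_ge0.
Qed.

Lemma eq_spline_cons n X Y e : spline n X =1 spline n Y ->
  spline n (e :: X) =1 spline n (e :: Y).
Proof. by move=> XY s /=; apply: eq_integral => t _; rewrite XY. Qed.

Lemma spline_cat_cons n X Y e : spline n (X ++ e :: Y) =1 spline n (e :: X ++ Y).
Proof.
elim: X => [|e' X IH] s //.
by rewrite cat_cons (eq_spline_cons _ IH) spline_swap.
Qed.

Lemma perm_spline n X Y : perm_eq X Y -> spline n X =1 spline n Y.
Proof.
elim: X Y => [|e X IH] Y.
  by rewrite perm_sym => /perm_nilP ->.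
move=> eXY; have eY : e \in Y by rewrite -(perm_mem eXY) mem_head.
have [Y1 [Y2 YE]] : exists Y1 Y2, Y = Y1 ++ e :: Y2.
  by case/splitPr: eY => Y1 Y2; exists Y1, Y2.
move=> s; rewrite YE spline_cat_cons; apply: eq_spline_cons; apply: IH.
by rewrite -(perm_cons e) (permPl eXY) YE perm_catC /= perm_cons perm_catC.
Qed.

(* The cone spanned by [e_i - e_j] and [e_j] is cut by the ray of their sum
   [e_i] into two cones. *)
Lemma spline_subdivide n X i j k s :
  spline n [:: (i, j), (j, k) & X] s =
  spline n [:: (i, j), (i, k) & X] s + spline n [:: (i, k), (j, k) & X] s.
Proof.
have colD l : edge_col (i, k) l = (edge_col (i, j) l + edge_col (j, k) l)%R.
  by rewrite /edge_col/=; ring.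
pose G (u v : R) := spline n X (push_flow (push_flow s u (i, j)) v (j, k)).
have mG (p q : R * R -> R) : measurable_fun setT p -> measurable_fun setT q ->
    measurable_fun [set: R * R] (fun z => G (p z) (q z)).
  move=> mp mq; apply: measurable_spline => l; apply: measurable_funB.
    by apply: measurable_funB => //; exact: measurable_funM.
  exact: measurable_funM.
have G0 u v : 0 <= G u v by exact: spline_ge0.
(* The quadrant is cut along its diagonal. On [v <= u] the substitution of [u + v] for [u] turns the
   generator [(j, k)] into [(i, k)]; on [u < v] that of [v + u] for [v] turns [(i, j)] into
   [(i, k)]. *)
pose f1 (u v : R) := if ((0 <= v) && (v <= u))%R then G u v else 0.
pose f2 (u v : R) := if ((0 <= u) && (u < v))%R then G u v else 0.
have mf1 : measurable_fun [set: R * R] (fun z => f1 z.1 z.2).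
  apply: measurable_fun_ifT => //; last exact: mG.
  by apply: measurable_and; exact: measurable_fun_ler.
have mf2 : measurable_fun [set: R * R] (fun z => f2 z.1 z.2).
  apply: measurable_fun_ifT => //; last exact: mG.
  by apply: measurable_and; [exact: measurable_fun_ler|exact: measurable_fun_ltr].
have f10 u v : 0 <= f1 u v by rewrite /f1; case: ifP.
have f20 u v : 0 <= f2 u v by rewrite /f2; case: ifP.
have -> : spline n [:: (i, j), (j, k) & X] s =
    \int[mu]_u \int[mu]_v f1 u v + \int[mu]_u \int[mu]_v f2 u v.
  rewrite spline_cons2 -ge0_integralD//=; last 4 first.
  - by move=> u _; apply: integral_ge0.
  - exact: measurable_integral_lebesgue.
  - by move=> u _; apply: integral_ge0.
  - exact: measurable_integral_lebesgue.
  apply: eq_integral => u _; rewrite -ge0_integralD//=; last 2 first.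
  - exact: (measurableT_comp mf1 (measurable_pair1 _)).
  - exact: (measurableT_comp mf2 (measurable_pair1 _)).
  apply: eq_integral => v _; rewrite /f1/f2/=.
  case: (leP 0%R u) => u0; case: (leP 0%R v) => v0; case: (leP v u) => uv //=; rewrite ?adde0 ?add0e//.
    by move: (lt_trans uv v0); rewrite ltNge u0.
  by move: (le_lt_trans uv u0); rewrite ltNge v0.
congr (_ + _).
- rewrite tonelli_lebesgue// [RHS]spline_swap spline_cons2.
  apply: eq_integral => v _; rewrite -(ge0_integral_shift v)//; last first.
    exact: (measurableT_comp mf1 (measurable_pair2 _)).
  apply: eq_integral => u _; rewrite /f1/= lerDr.
  case: ifP => // _; congr spline; apply/funext => l; rewrite /push_flow colD.
  by ring.
- apply: eq_integral => u _; case: (leP 0%R u) => u0; last first.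
    by apply: integral0_eq => v _; rewrite /f2/= lt_geF.
  rewrite -(ge0_integral_shift u)//; last first.
    exact: (measurableT_comp mf2 (measurable_pair1 _)).
  pose h v := spline n X (push_flow (push_flow s u (i, k)) v (j, k)).
  transitivity (\int[mu]_(v in `]0%R, +oo[) h v).
    rewrite [RHS]integral_mkcond; apply: eq_integral => v _.
    rewrite patchE mem_setE in_itv/= andbT /f2/= ltrDr u0/=.
    case: ifP => // v0.
    congr spline; apply/funext => l; rewrite /push_flow colD.
    by ring.
  rewrite integral_itv_obnd_cbnd.
    rewrite integral_mkcond; apply: eq_integral => v _.
    by rewrite patchE mem_setE in_itv/= andbT.
  by apply: (@measurable_funS _ _ _ _ setT) => //; exact: measurable_push_flow.
Qed.

End Spline.

(** * Moments, bounds and finiteness of splines *)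

Section Moment.
Context (R : realType).
Local Notation mu := (@lebesgue_measure R).
Implicit Types (s w : nat -> R) (e : nat * nat) (X : seq (nat * nat)).

Local Open Scope ereal_scope.

(** The form with an explicit domain, to which the lemmas on integrals over intervals apply. *)
Lemma spline_cons n e X s :
  spline n (e :: X) s = \int[mu]_(t in `[0%R, +oo[) spline n X (push_flow s t e).
Proof.
rewrite [RHS]integral_mkcond; apply: eq_integral => t _.
by rewrite patchE mem_setE in_itv/= andbT.
Qed.

Let mpush n X s e (D : set R) : measurable D ->
  measurable_fun D (fun t => spline n X (push_flow s t e)).
Proof. by move=> mD; apply: (@measurable_funS _ _ _ _ setT) => //; exact: measurable_push_flow. Qed.

Lemma spline_cons_double n e X s :
  spline n [:: e, e & X] s =
  \int[mu]_(t in `[0%R, +oo[) (t%:E * spline n X (push_flow s t e)).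
Proof.
pose h t := spline n X (push_flow s t e).
have mh : measurable_fun setT h by exact: mpush.
have h0 t : 0 <= h t by exact: spline_ge0.
(* Here [u] is the total flow on the two copies and [t] its share on the first; integrating out [t]
   over [[0, u]] produces the weight [u]. *)
pose f (t u : R) := if ((0 <= t) && (t <= u))%R then h u else 0.
have mf : measurable_fun [set: R * R] (fun z => f z.1 z.2).
  apply: measurable_fun_ifT => //; last exact: (measurableT_comp mh).
  by apply: measurable_and; exact: measurable_fun_ler.
have f0 t u : 0 <= f t u by rewrite /f; case: ifP.
transitivity (\int[mu]_t \int[mu]_u f t u).
  rewrite spline_cons2; apply: eq_integral => t _.
  rewrite -[RHS](ge0_integral_shift t)//; last first.
    exact: (measurableT_comp mf (measurable_pair1 _)).
  apply: eq_integral => u _; rewrite /f lerDr.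
  case: ifP => // _; congr spline; apply/funext => k; rewrite /push_flow.
  by ring.
rewrite tonelli_lebesgue// [RHS]integral_mkcond; apply: eq_integral => u _.
rewrite patchE mem_setE in_itv/= andbT.
have [u0|u0] := leP 0%R u; last first.
  by apply: integral0_eq => t _; rewrite /f; case: ifP => // /andP[/le_trans h1 /h1]; rewrite leNgt u0.
transitivity (\int[mu]_(t in `[0%R, u]) h u).
  rewrite [RHS]integral_mkcond; apply: eq_integral => t _.
  by rewrite patchE mem_setE in_itv/=.
rewrite integral_cst//= lebesgue_measure_itv/= lte_fin muleC.
case: ltgtP u0 => // [u0 _|<- _]; first by rewrite -EFinB subr0.
by [].
Qed.

Definition pairing n w s : R := (\sum_(k < n) w k * s k)%R.

Definition is_edge n e := (e.1 < e.2 <= n)%N.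

Lemma pairing_push_flow n w s t e : is_edge n e -> w n = 0%R ->
  pairing n w (push_flow s t e) = (pairing n w s - t * (w e.1 - w e.2))%R.
Proof.
move=> /andP[e12 e2n] wn; rewrite /pairing /push_flow.
have Hw (j : nat) : (j <= n)%N -> (\sum_(k < n) w k * ((k : nat) == j)%:R = w j)%R.
  rewrite leq_eqVlt => /predU1P[->|jn].
    by rewrite wn big1// => k _; rewrite ltn_eqF ?mulr0.
  rewrite (bigD1 (Ordinal jn))//= eqxx mulr1 big1 ?addr0// => k.
  by rewrite -val_eqE/= => /negbTE ->; rewrite mulr0.
rewrite -(Hw e.1) ?(leq_trans (ltnW e12))// -(Hw e.2)//.
rewrite -sumrB mulr_sumr -sumrB; apply: eq_bigr => k _; rewrite /edge_col.
ring.
Qed.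

(** A potential that vanishes at the sink and does not increase along any edge: pushing flow can
    then only lower the pairing with the supplies. *)
Definition compatible n w X := [/\ forall k, (k < n)%N -> (0 <= w k)%R, w n = 0%R &
  forall e, e \in X -> is_edge n e && (w e.2 <= w e.1)%R].

Lemma compatible_cons n w e X : compatible n w (e :: X) <->
  compatible n w X /\ is_edge n e && (w e.2 <= w e.1)%R.
Proof.
split=> [[w0 wn wX]|[[w0 wn wX] we]].
  by split; [split=> // e' e'X; apply: wX; rewrite in_cons e'X orbT|apply: wX; rewrite mem_head].
by split=> // e'; rewrite in_cons => /predU1P[->//|/wX].
Qed.

Lemma spline_eq0 n w X s : compatible n w X -> (pairing n w s < 0)%R ->
  spline n X s = 0.
Proof.
elim: X s => [|e X IH] s /=.
  case=> w0 _ _ s0; case: allP => //= sk; move: s0; rewrite ltNge => /negP[].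
  apply: sumr_ge0 => k _; apply: mulr_ge0; first exact: w0.
  by apply: sk; rewrite mem_iota/=.
move=> /compatible_cons[wX /andP[en we]] s0; apply: integral0_eq => t _.
case: ifP => // t0; apply: IH => //; case: (wX) => _ wn _.
rewrite pairing_push_flow//; apply: le_lt_trans s0.
by rewrite lerBlDr lerDl mulr_ge0// subr_ge0.
Qed.

(** For every flow, pairing conservation with [w] writes [pairing n w s] as the sum of the flows
    weighted by the drops of [w]. Integrating the flow on an edge doubles the edge
    ([spline_cons_double]). Compatibility makes all weights nonnegative, so the identity already
    makes sense in the extended reals. *)
Lemma spline_moment n w X s : compatible n w X ->
  (pairing n w s)%:E * spline n X s =
  \sum_(e <- X) (w e.1 - w e.2)%:E * spline n (e :: X) s +
  \sum_(i < n) (w i)%:E * spline n ((i : nat, n) :: X) s.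
Proof.
elim: X s => [|e0 X IH] s wX.
  case: (wX) => w0 wn _.
  rewrite big_nil add0e.
  have [/allP s0|s0] := boolP (all (fun k => 0 <= s k)%R (iota 0 n)); last first.
    rewrite /= (negbTE s0) mule0 big1// => i _.
    rewrite integral0_eq ?mule0// => t _; case: ifP => // t0.
    case: allP => // ps; case/negP: s0; apply/allP => k kn; move: (ps k kn).
    move: kn; rewrite mem_iota/= add0n => kn; rewrite /push_flow /edge_col/= (ltn_eqF kn) subr0.
    by move=> h; apply: (le_trans h); rewrite lerBlDr lerDl mulr_ge0.
  have -> : spline n [::] s = 1.
    by rewrite /=; case: allP.
  rewrite mule1 /pairing -sumEFin; apply: eq_bigr => i _.
  rewrite EFinM; congr (_ * _); apply/esym; rewrite spline_cons.
  (* When no other edge is left, the flow that can be pushed along [(i, n)] ranges over [[0, s i]],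
     of length [s i]. *)
  transitivity (\int[mu]_(t in `[0%R, s i]) 1).
    rewrite [LHS]integral_mkcond [RHS]integral_mkcond; apply: eq_integral => t _.
    rewrite !patchE !mem_setE !in_itv/= andbT.
    case: (leP 0%R t) => //= t0.
    have <- : all (fun k => 0 <= push_flow s t (i : nat, n) k)%R (iota 0 n) = (t <= s i)%R.
      apply/allP/idP => [/(_ i)|tsi k].
        rewrite mem_iota/= add0n ltn_ord => /(_ isT).
        by rewrite /push_flow /edge_col/= eqxx (ltn_eqF (ltn_ord i)) subr0 mulr1 subr_ge0.
      move=> kin; move: (kin); rewrite mem_iota/= add0n => kn.
      rewrite /push_flow /edge_col/= (ltn_eqF kn) subr0.
      case: eqP => [->|_]; first by rewrite mulr1 subr_ge0.
      by rewrite mulr0 subr0; exact: s0.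
    by case: all.
  have si0 : (0 <= s i)%R by apply: s0; rewrite mem_iota/=.
  rewrite integral_cst//= mul1e lebesgue_measure_itv/= lte_fin.
  by case: ltgtP si0 => // [_ _|<- _]; first by rewrite -EFinB subr0.
have /compatible_cons[wX' /andP[en we]] := wX.
case: (wX') => w0 wn wX''.
have Hi (i : 'I_n) : compatible n w [:: (i : nat, n), e0 & X].
  by apply/compatible_cons; split => //; rewrite /is_edge/= ltn_ord leqnn wn w0.
(* A negative factor cannot enter the integral through [ge0_integralZl], but in that case every
   spline involved vanishes. *)
have [s0|s0] := ltP (pairing n w s) 0%R.
  rewrite (spline_eq0 wX s0) mule0 big_seq !big1 ?adde0// => [i _|e eX].
    by rewrite (spline_eq0 (Hi i) s0) mule0.
  have wX3 : compatible n w [:: e, e0 & X].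
    by apply/compatible_cons; split=> //; case: wX => _ _; apply.
  by rewrite (spline_eq0 wX3 s0) mule0.
pose p t := push_flow s t e0.
have mp Y (D : set R) : measurable D -> measurable_fun D (fun t => spline n Y (p t)).
  exact: mpush.
have cX e : e \in X -> (0 <= w e.1 - w e.2)%R.
  by move=> /wX''/andP[_]; rewrite subr_ge0.
(* The pairing before pushing [t] along [e0] is the pairing after it, handled by induction, plus [t]
   times the drop of [w] along [e0]. *)
transitivity (\int[mu]_(t in `[0%R, +oo[)
   ((\sum_(e <- X) (w e.1 - w e.2)%:E * spline n (e :: X) (p t) +
     \sum_(i < n) (w i)%:E * spline n ((i : nat, n) :: X) (p t)) +
    (w e0.1 - w e0.2)%:E * (t%:E * spline n X (p t)))).
  rewrite spline_cons -ge0_integralZl//; last 2 first.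
  - exact: mp.
  - by move=> t _; exact: spline_ge0.
  apply: eq_integral => t; rewrite mem_setE/= in_itv/= andbT => t0.
  rewrite -IH// muleA -EFinM /p.
  have [pt|pt] := ltP (pairing n w (push_flow s t e0)) 0%R.
    by rewrite (spline_eq0 wX' pt) !mule0 adde0.
  rewrite -ge0_muleDl ?lee_fin//; last by rewrite mulr_ge0// subr_ge0.
  congr (_ * _); rewrite -EFinD pairing_push_flow//; congr EFin; ring.
have mZ (k : R) Y (D : set R) : measurable D ->
    measurable_fun D (fun t => k%:E * spline n Y (p t)).
  by move=> mD; apply: measurable_funeM; exact: mp.
have Zge0 (k : R) Y t : (0 <= k)%R -> 0 <= k%:E * spline n Y (p t).
  by move=> k0; rewrite mule_ge0 ?lee_fin// spline_ge0.
have S1ge0 t : 0 <= \sum_(e <- X) (w e.1 - w e.2)%:E * spline n (e :: X) (p t).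
  by rewrite big_seq; apply: sume_ge0 => e eX; apply: Zge0; exact: cX.
have S2ge0 t : 0 <= \sum_(i < n) (w i)%:E * spline n ((i : nat, n) :: X) (p t).
  by apply: sume_ge0 => i _; apply: Zge0; exact: w0.
have mS1 : measurable_fun (`[0%R, +oo[ : set R) (fun t =>
    \sum_(e <- X) (w e.1 - w e.2)%:E * spline n (e :: X) (p t)).
  by apply: emeasurable_sum => e; exact: mZ.
have mS2 : measurable_fun (`[0%R, +oo[ : set R) (fun t =>
    \sum_(i < n) (w i)%:E * spline n ((i : nat, n) :: X) (p t)).
  by apply: emeasurable_sum => i; exact: mZ.
have mtp : measurable_fun (`[0%R, +oo[ : set R) (fun t => t%:E * spline n X (p t)).
  by apply: emeasurable_funM; [exact/measurable_EFinP|exact: mp].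
rewrite ge0_integralD//; last 4 first.
- by move=> t _; rewrite adde_ge0.
- exact: emeasurable_funD.
- move=> t; rewrite /= in_itv/= andbT => t0; rewrite !mule_ge0 ?lee_fin ?subr_ge0//.
  exact: spline_ge0.
- exact: measurable_funeM.
rewrite ge0_integralD// big_cons -[RHS]addeA [RHS]addeC.
congr (_ + _); last first.
  rewrite ge0_integralZl//.
  - by rewrite spline_cons_double.
  - move=> t; rewrite /= in_itv/= andbT => t0; rewrite mule_ge0 ?lee_fin//.
    exact: spline_ge0.
  - by rewrite lee_fin subr_ge0.
congr (_ + _); last first.
  rewrite ge0_integral_sum//; last 2 first.
  - by move=> i; exact: mZ.
  - by move=> i t _; apply: Zge0; exact: w0.
  apply: eq_bigr => i _; rewrite ge0_integralZl//.
  - by rewrite spline_swap spline_cons.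
  - exact: mp.
  - by move=> t _; exact: spline_ge0.
  - by rewrite lee_fin w0.
under eq_integral do rewrite big_tnth.
rewrite ge0_integral_sum//; last 2 first.
- by move=> i; exact: mZ.
- by move=> i t _; apply: Zge0; apply: cX; exact: mem_tnth.
rewrite [RHS]big_tnth; apply: eq_bigr => i _; rewrite ge0_integralZl//.
- by rewrite spline_swap spline_cons.
- exact: mp.
- by move=> t _; exact: spline_ge0.
- by rewrite lee_fin cX// mem_tnth.
Qed.

Definition height n k : R := (n - k)%:R.

Lemma compatible_height n X : all (is_edge n) X -> compatible n (height n) X.
Proof.
move=> /allP XE; split=> [k _||e eX].
- by rewrite /height ler0n.
- by rewrite /height subnn.
- rewrite XE//= /height ler_nat leq_sub2l// ltnW//.
  by case/andP: (XE _ eX).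
Qed.

(** [height] drops by at least one along each edge, so a flow larger than the pairing makes it
    negative and the integrand zero. Each edge thus contributes at most a factor equal to the
    pairing; the aim is finiteness. *)
Lemma spline_le n X s : all (is_edge n) X ->
  spline n X s <= (Num.max 0 (pairing n (height n) s) ^+ size X)%:E.
Proof.
elim: X s => [|e X IH] s.
  by move=> _ /=; rewrite expr0 lee_fin lern1; case: all.
move=> eX; have [sneg|spos] := ltP (pairing n (height n) s) 0%R.
  by rewrite (spline_eq0 (compatible_height eX) sneg) lee_fin exprn_ge0.
have /andP[en XE] := eX.
rewrite spline_cons.
set M := pairing n _ _.
have e1 : (1 <= height n e.1 - height n e.2)%R.
  move: en => /andP[e12 e2n].
  rewrite /height -natrB ?leq_sub2l ?(ltnW e12)// ler1n subn_gt0.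
  by rewrite ltn_sub2l// (leq_trans e12).
have hn : height n n = 0%R by rewrite /height subnn.
have pE t : pairing n (height n) (push_flow s t e) = (M - t * (height n e.1 - height n e.2))%R.
  exact: pairing_push_flow.
rewrite (_ : \int[mu]_(t in _) _ = \int[mu]_(t in `[0%R, M]) spline n X (push_flow s t e)).
  apply: (@le_trans _ _ (\int[mu]_(t in `[0%R, M]) (cst (M ^+ size X)%:E t))).
    apply: ge0_le_integral => //.
    - by move=> t _; exact: spline_ge0.
    - exact: mpush.
    - move=> t; rewrite /= in_itv/= => /andP[t0 tM].
      apply: (le_trans (IH _ XE)); rewrite lee_fin; apply: lerXn2r.
      + by rewrite nnegrE le_max lexx.
      + by rewrite nnegrE.
      + rewrite ge_max spos pE lerBlDr lerDl mulr_ge0//.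
        exact: le_trans e1.
  rewrite integral_cst//= lebesgue_measure_itv/= lte_fin.
  case: ltgtP spos => // [M0 _|<- _].
    by rewrite -EFinB subr0 -EFinM lee_fin exprSr.
  by rewrite mule0 lee_fin exprn_ge0.
rewrite [LHS]integral_mkcond [RHS]integral_mkcond; apply: eq_integral => t _.
rewrite !patchE !mem_setE !in_itv/= andbT.
have [t0|//] := leP 0%R t; have [//|tM] := leP t M.
apply: (@spline_eq0 _ (height n)); first exact: compatible_height.
rewrite pE subr_lt0; apply: (lt_le_trans tM).
by rewrite ler_peMr.
Qed.

Lemma spline_fin_num n X s : all (is_edge n) X -> spline n X s \is a fin_num.
Proof.
move=> XE; rewrite ge0_fin_numE ?spline_ge0//.
by apply: (le_lt_trans (spline_le s XE)); rewrite ltry.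
Qed.

Local Close Scope ereal_scope.

Definition rspline n X s : R := fine (spline n X s).

(* The flow out of vertex [k] minus the flow into it is [s k] on the whole
   polytope, and integrating the flow along an edge amounts to doubling it. *)
Lemma rspline_balance n X s k : all (is_edge n) X -> (k < n)%N ->
  s k * rspline n X s =
  \sum_(e <- X) edge_col R e k * rspline n (e :: X) s + rspline n ((k, n) :: X) s.
Proof.
move=> XE kn.
have XcE e : e \in X -> all (is_edge n) (e :: X).
  by move=> eX /=; rewrite XE andbT; exact: (allP XE).
have XiE (i : nat) : (i < n)%N -> all (is_edge n) ((i, n) :: X).
  by move=> i_n /=; rewrite XE andbT /is_edge/= i_n leqnn.
have mom w : compatible n w X -> pairing n w s * rspline n X s =
    \sum_(e <- X) (w e.1 - w e.2) * rspline n (e :: X) s +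
    \sum_(i < n) w i * rspline n ((i : nat, n) :: X) s.
  move=> cw; apply: EFin_inj; rewrite EFinM fineK ?spline_fin_num// spline_moment//.
  rewrite EFinD; congr (_ + _)%E.
    rewrite -sumEFin big_seq [RHS]big_seq; apply: eq_bigr => e eX.
    by rewrite EFinM fineK// spline_fin_num// XcE.
  rewrite -sumEFin; apply: eq_bigr => i _.
  by rewrite EFinM fineK// spline_fin_num// XiE.
(* The indicator of [k] alone increases along edges into [k]. Adding [height], whose drops are at
   least one, restores compatibility; subtracting the identity for [height] isolates the
   indicator. *)
pose w2 (j : nat) := height n j + (j == k)%:R.
have cw2 : compatible n w2 X.
  case: (compatible_height XE) => h0 hn hX; split=> [j jn|| e eX].
  - by rewrite /w2 addr_ge0// h0.
  - by rewrite /w2 hn gtn_eqF// addr0.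
  - case/andP: (hX _ eX) => en _; rewrite en /=.
    case/andP: en => e12 _; rewrite /w2 /height -!natrD ler_nat.
    case: eqP => h2; case: eqP => h1 /=; lia.
have := mom _ cw2.
rewrite (_ : pairing n w2 s = pairing n (height n) s + s k); last first.
  rewrite /pairing /w2; under eq_bigr do rewrite mulrDl.
  rewrite big_split/=; congr (_ + _).
  rewrite (bigD1 (Ordinal kn))//= eqxx mul1r big1 ?addr0// => i.
  by rewrite -val_eqE/= => /negbTE ->; rewrite mul0r.
rewrite mulrDl (mom _ (compatible_height XE)).
under [X in _ = X + _ -> _]eq_bigr => e _.
  rewrite (_ : w2 e.1 - w2 e.2 = (height n e.1 - height n e.2) + edge_col R e k); last first.
    by rewrite /w2 /edge_col ![_ == k]eq_sym; ring.
  rewrite mulrDl; over.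
under [X in _ = _ + X -> _]eq_bigr => i _ do rewrite /w2 mulrDl.
rewrite !big_split/= [X in _ = _ + (_ + X) -> _](_ : _ = rspline n ((k, n) :: X) s); last first.
  rewrite (bigD1 (Ordinal kn))//= eqxx mul1r big1 ?addr0// => i.
  by rewrite -val_eqE/= => /negbTE ->; rewrite mul0r.
by move=> h; lra.
Qed.

Lemma rspline_subdivide n X i j k s :
  all (is_edge n) X -> is_edge n (i, j) -> is_edge n (j, k) ->
  rspline n [:: (i, j), (j, k) & X] s =
  rspline n [:: (i, j), (i, k) & X] s + rspline n [:: (i, k), (j, k) & X] s.
Proof.
move=> XE ij jk; have ik : is_edge n (i, k).
  by move: ij jk; rewrite /is_edge/=; lia.
rewrite /rspline spline_subdivide fineD//; apply: spline_fin_num => /=.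
  by rewrite ij ik.
by rewrite ik jk.
Qed.

(* The last non-sink vertex has a single outgoing edge, which can be
   contracted. *)
Lemma spline_contract n X s : (0 <= s n)%R -> all (is_edge n.+1) X ->
  (n, n.+1) \notin X ->
  spline n.+1 X s = spline n [seq (e.1, minn e.2 n) | e <- X] s.
Proof.
elim: X s => [|[i j] X IH] s sn.
  have E : iota 0 n.+1 = rcons (iota 0 n) n by rewrite -addn1 iotaD cats1.
  by move=> _ _; rewrite [LHS]/spline E all_rcons sn.
rewrite [all _ _]/= in_cons negb_or => /andP[en XE] /andP[ne nX] /=.
have e1n : (i < n)%N by move: ne en; rewrite xpair_eqE /is_edge/=; lia.
apply: eq_integral => t _; case: ifP => // t0.
(* No edge of the list leaves [n], so pushing flow can only increase the supply there and its sign
   test keeps succeeding. *)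
rewrite IH//; last first.
  rewrite /push_flow /edge_col (gtn_eqF e1n) sub0r mulrN opprK addr_ge0//.
  by rewrite mulr_ge0.
apply: eq_spline => k kn; rewrite /push_flow /edge_col/=.
rewrite (_ : (k == j) = (k == minn j n)) //; lia.
Qed.

End Moment.

(** * Aomoto's recursion *)

Section Multiset.
Implicit Types (mu : nat * nat -> nat).

Lemma count_flatten_nseq (T : eqType) (f : T -> nat) (s : seq T) x : uniq s ->
  count_mem x (flatten [seq nseq (f e) e | e <- s]) = if x \in s then f x else 0%N.
Proof.
elim: s => //= y s IH /andP[ys us]; rewrite count_cat IH// count_nseq/= in_cons.
rewrite [y == x]eq_sym; have [->|yx] := eqVneq x y.
  by rewrite (negbTE ys) mul1n addn0.
by rewrite mul0n.
Qed.

Definition edge_list n : seq (nat * nat) :=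
  [seq e <- allpairs pair (iota 0 n.+1) (iota 0 n.+1) | (e.1 < e.2)%N].

Lemma mem_edge_list n e : (e \in edge_list n) = is_edge n e.
Proof.
case: e => i j; rewrite mem_filter; apply/andP/andP => -[ij].
  move=> /allpairsP[[i' j'] [_ jn [_ jj]]].
  by move: jn; rewrite mem_iota -jj.
move=> jn; split=> //; apply/allpairsP; exists (i, j).
by rewrite !mem_iota !add0n !ltnS; split=> //; exact: (leq_trans (ltnW ij)).
Qed.

Lemma edge_list_uniq n : uniq (edge_list n).
Proof.
by apply: filter_uniq; apply: allpairs_uniq; rewrite ?iota_uniq// => -[? ?] [? ?].
Qed.

(** A canonical listing: graphs become functions [mu], and two lists with equal multiplicities have
    equal splines by [perm_spline]. *)
Definition multi_list n mu : seq (nat * nat) :=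
  flatten [seq nseq (mu e) e | e <- edge_list n].

Lemma count_multi_list n mu e :
  count_mem e (multi_list n mu) = if is_edge n e then mu e else 0%N.
Proof. by rewrite count_flatten_nseq ?edge_list_uniq// mem_edge_list. Qed.

Lemma multi_list_edges n mu : all (is_edge n) (multi_list n mu).
Proof.
apply/allP => e; rewrite -has_pred1 has_count count_multi_list.
by case: ifP.
Qed.

Lemma eq_count_perm (T : eqType) (s t : seq T) :
  (forall x, count_mem x s = count_mem x t) -> perm_eq s t.
Proof. by move=> st; apply/allP => x _ /=; rewrite st. Qed.

Definition add_edge mu e : nat * nat -> nat := fun x => (mu x + (x == e))%N.

Lemma perm_add_edge n mu e : is_edge n e ->
  perm_eq (e :: multi_list n mu) (multi_list n (add_edge mu e)).
Proof.
move=> en; apply: eq_count_perm => x /=; rewrite !count_multi_list /add_edge eq_sym.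
have [->|] := eqVneq x e; first by rewrite en addnC.
by rewrite add0n addn0.
Qed.

Lemma big_multi_list (R : realType) n mu (F : nat * nat -> R) :
  \sum_(e <- multi_list n mu) F e = \sum_(e <- edge_list n) (mu e)%:R * F e.
Proof.
rewrite big_flatten big_map; apply: eq_bigr => e _.
by rewrite big_nseq mulr_natl; elim: (mu e) => //= k ->; rewrite mulrS.
Qed.

Lemma big_edge_list (R : realType) n (F : nat * nat -> R) :
  \sum_(e <- edge_list n) F e =
  \sum_(i < n) \sum_(j < n | (i < j)%N) F (i : nat, j : nat) +
  \sum_(i < n) F (i : nat, n).
Proof.
rewrite big_filter big_mkcond big_allpairs -[iota 0 n.+1]/(index_iota 0 n.+1).
rewrite big_mkord big_ord_recr/=.
rewrite [X in _ + X]big_mkord [X in _ + X]big1 ?addr0; last first.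
  by move=> j _; rewrite ltnNge -ltnS ltn_ord.
rewrite -big_split/=; apply: eq_bigr => i _.
rewrite big_mkord big_ord_recr/= ltn_ord; congr (_ + _).
by rewrite [RHS]big_mkcond.
Qed.

End Multiset.

(** * Relations between volumes with unit supplies *)

Section Volume.
Context (R : realType).
Implicit Types (mu : nat * nat -> nat).

(* The volume of the polytope of flows with unit supplies in the graph with
   [(mu e).+1] copies of the edge [e] when [e] goes to the sink [n], and [mu e]
   copies otherwise. *)
Definition flow_volume n mu : R := rspline n (multi_list n mu) (fun=> 1).

Lemma flow_volume_add n mu (l : seq (nat * nat)) : all (is_edge n) l ->
  rspline n (l ++ multi_list n mu) (fun=> 1 : R) = flow_volume n (foldl add_edge mu l).
Proof.
elim: l mu => //= e l IH mu /andP[en ln]; rewrite -IH//.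
rewrite /rspline -cat_cons; congr fine; apply: perm_spline.
by rewrite -cat1s -catA perm_catCA perm_cat2l perm_add_edge.
Qed.

(** The [mu e] copies of an edge contribute equally; the last term comes from the sink edge at [k]
    that [spline] leaves implicit. *)
Lemma flow_volume_balance n mu k : (k < n)%N ->
  flow_volume n mu =
  \sum_(e <- edge_list n) (mu e)%:R * (edge_col R e k * flow_volume n (add_edge mu e)) +
  flow_volume n (add_edge mu (k, n)).
Proof.
move=> kn; rewrite -[LHS]mul1r.
rewrite [LHS](rspline_balance (fun=> 1) (multi_list_edges n mu) kn) big_multi_list.
have E e : is_edge n e -> rspline n (e :: multi_list n mu) (fun=> 1 : R) =
    flow_volume n (add_edge mu e).
  by move=> en; rewrite -(@flow_volume_add _ _ [:: e])//= en.
congr (_ + _); last by apply: E; rewrite /is_edge/= kn leqnn.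
rewrite big_seq [RHS]big_seq; apply: eq_bigr => e.
by rewrite mem_edge_list => en; rewrite E.
Qed.

Lemma flow_volume_subdivide n mu i j : (i < j)%N -> (j < n)%N ->
  flow_volume n (add_edge (add_edge mu (j, n)) (i, j)) =
  flow_volume n (add_edge (add_edge mu (i, n)) (i, j)) +
  flow_volume n (add_edge (add_edge mu (j, n)) (i, n)).
Proof.
move=> ij jn.
have ijn : is_edge n (i, j) by rewrite /is_edge/= ij ltnW.
have jnn : is_edge n (j, n) by rewrite /is_edge/= jn leqnn.
have inn : is_edge n (i, n) by rewrite /is_edge/= (ltn_trans ij jn) leqnn.
have := @rspline_subdivide R n (multi_list n mu) i j n (fun=> 1) (multi_list_edges n mu) ijn jnn.
have E e e' : is_edge n e -> is_edge n e' ->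
    rspline n [:: e, e' & multi_list n mu] (fun=> 1 : R) =
    flow_volume n (add_edge (add_edge mu e') e).
  move=> en en'; have := @flow_volume_add n mu [:: e'; e].
  rewrite [all _ _]/= en en' => /(_ isT) <-.
  by rewrite /rspline !cat_cons cat0s (spline_swap _ _ e' e).
by rewrite (E _ _ ijn jnn) (E _ _ ijn inn) (E _ _ inn jnn).
Qed.

Lemma sum_sets_notin (T : finType) (V : nmodType) (u : nat) (k : T) (G : {set T} -> V) :
  \sum_(U : {set T} | (#|U| == u) && (k \notin U)) G U =
  \sum_(W : {set T} | (#|W| == u.+1) && (k \in W)) G (W :\ k).
Proof.
rewrite (reindex_onto (fun W => W :\ k) (fun U => k |: U)) => [|U /andP[_ kU]].
  apply: eq_bigl => W; rewrite finset.setD11 andbT.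
  have [kW|kW] := boolP (k \in W).
    by rewrite finset.setD1K// eqxx !andbT [in RHS](finset.cardsD1 k) kW.
  rewrite andbF; apply/negP => /andP[_ /eqP] E; move: kW.
  by rewrite -E finset.setU11.
by rewrite finset.setU1K.
Qed.

(** Adding the sum to its mirror image counts the ordered pairs of distinct elements of [W]. *)
Lemma sum_pairs_in (n : nat) (W : {set 'I_n}) :
  \sum_(i < n) \sum_(j < n | (i < j)%N) ((i \in W) && (j \in W))%:R =
  (#|W| * #|W|.-1)%:R / 2 :> R.
Proof.
pose F (i j : 'I_n) : R := ((i \in W) && (j \in W))%:R.
have E : \sum_(i < n) \sum_(j < n | (i < j)%N) F i j +
    \sum_(i < n) \sum_(j < n | (i < j)%N) F i j = (#|W| * #|W|.-1)%:R.
  rewrite [X in _ + X](exchange_big_dep xpredT)//= -big_split/=.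
  transitivity (\sum_(i < n) (i \in W)%:R * (#|W|.-1)%:R : R).
    apply: eq_bigr => i _.
    have [iW|iW] := boolP (i \in W); last first.
      by rewrite mul0r !big1 ?addr0// => j _; rewrite /F (negbTE iW) ?andbF.
    rewrite mul1r (finset.cardsD1 i) iW/= -sum1_card natr_sum.
    rewrite [LHS](_ : _ = \sum_(j < n | j != i) (j \in W)%:R); last first.
      rewrite [RHS](bigID (fun j : 'I_n => (i < j)%N))/=; congr (_ + _).
        apply: eq_big => j; last by rewrite /F iW.
        by rewrite -val_eqE/= neq_ltn; lia.
      apply: eq_big => j; last by rewrite /F iW andbT.
      by rewrite -val_eqE/=; lia.
    rewrite [RHS](eq_bigl (fun j => (j != i) && (j \in W))); last by move=> j; rewrite !inE.
    by rewrite [RHS]big_mkcondr; apply: eq_bigr => j _; case: (j \in W).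
  rewrite -mulr_suml natrM; congr (_ * _).
  by rewrite -sum1_card natr_sum [RHS]big_mkcond/=; apply: eq_bigr => i _; case: (i \in W).
by apply: (@mulIf _ 2%:R); rewrite ?pnatr_eq0// divfK ?pnatr_eq0// -E mulr2n mulrDr mulr1.
Qed.

Section Aomoto.
Variables (n a m : nat).

(* [b = m + 2], except that the sink edges of the vertices outside [U] have
   multiplicity [m + 1]. *)
Definition sink_mult (U : {set 'I_n}) (e : nat * nat) : nat :=
  if e.2 == n then (m + (e.1 \in map val (enum U)))%N else a.

Let mem_val (U : {set 'I_n}) (k : 'I_n) : ((k : nat) \in map val (enum U)) = (k \in U).
Proof. by rewrite mem_map ?mem_enum//; exact: val_inj. Qed.

Lemma sink_multU1 (U : {set 'I_n}) k : k \notin U ->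
  sink_mult (k |: U) = add_edge (sink_mult U) (k : nat, n).
Proof.
move=> kU; apply/funext => -[i j]; rewrite /sink_mult /add_edge/= xpair_eqE.
case: eqP => _; last by rewrite andbF addn0.
rewrite andbT -addnA; congr addn; have [->|ik] := eqVneq i k.
  by rewrite !mem_val finset.setU11 (negbTE kU).
rewrite addn0; congr nat_of_bool.
apply/mapP/mapP => -[x]; rewrite mem_enum => xW ix; exists x => //; rewrite mem_enum.
  move: xW; rewrite finset.in_setU1 => /predU1P[xk|//].
  by move: ik; rewrite ix xk eqxx.
by rewrite finset.in_setU1 xW orbT.
Qed.

Let A U := flow_volume n (sink_mult U).
Let B (i j : 'I_n) U := flow_volume n (add_edge (sink_mult U) (i : nat, j : nat)).

Definition elementary_volume u := \sum_(U : {set 'I_n} | #|U| == u) A U.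
Local Notation E := elementary_volume.

(** A vertex outside [U] has [m] listed sink edges and an implicit one, whence the coefficient
    [m.+1]; the other edges at [k] are inner ones, of multiplicity [a]. *)
Lemma sink_mult_balance (U : {set 'I_n}) k : k \notin U ->
  A U = m.+1%:R * A (k |: U) +
    a%:R * \sum_(i < n) \sum_(j < n | (i < j)%N) ((k == i)%:R - (k == j)%:R) * B i j U.
Proof.
move=> kU; rewrite {1}/A (flow_volume_balance _ (ltn_ord k)) -sink_multU1//.
rewrite big_edge_list [X in _ + X + _](_ : _ = m%:R * A (k |: U)); last first.
  rewrite (bigD1 k)//= big1 ?addr0 => [|i ik].
    rewrite /A sink_multU1// /sink_mult/= eqxx mem_val (negbTE kU) addn0.
    by rewrite /edge_col/= eqxx (ltn_eqF (ltn_ord k)) subr0 mul1r.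
  by rewrite /edge_col/= val_eqE eq_sym (negbTE ik) (ltn_eqF (ltn_ord k)) subr0 mul0r mulr0.
rewrite -addrA addrC -/(A (k |: U)); congr (_ + _).
  by rewrite -natr1; ring.
rewrite mulr_sumr; apply: eq_bigr => i _; rewrite mulr_sumr; apply: eq_bigr => j _.
by rewrite /sink_mult/= (ltn_eqF (ltn_ord j)) /edge_col/= !val_eqE.
Qed.

(** Subdivision of [i -> j -> n] over the set [W] deprived of [i] and [j]: the two volumes that
    contain the edge [(i, j)] differ by the one with both additional sink edges. *)
Lemma sink_mult_subdivide (i j : 'I_n) (W : {set 'I_n}) : (i < j)%N ->
  i \in W -> j \in W -> B i j (W :\ i) - B i j (W :\ j) = A W.
Proof.
move=> ij iW jW.
have ji : j != i by rewrite -val_eqE/= gtn_eqF.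
pose U := W :\ i :\ j.
have iU : i \notin U by rewrite !inE eqxx andbF.
have jU : j \notin U by rewrite !inE eqxx.
have Wi : W :\ i = j |: U by rewrite finset.setD1K// !inE ji.
have Wj : W :\ j = i |: U.
  rewrite -[in LHS](finset.setD1K iW); apply/finset.setP => x; rewrite !inE.
  by have [->|] := eqVneq x i; rewrite ?andbT ?andbF//= ?(eq_sym i) ?ji.
rewrite /A /B -[in RHS](finset.setD1K iW) Wi Wj.
rewrite !sink_multU1// ?(flow_volume_subdivide _ ij (ltn_ord j)).
  by rewrite addrC addKr.
by rewrite finset.in_setU1 negb_or iU andbT eq_sym.
Qed.

(** Only [k = i] and [k = j] survive, with opposite signs, and the sets that avoid both cancel. What
    is left matches [W] without [i] against [W] without [j], for [W] containing both. *)
Let pair_sum u (i j : 'I_n) : (i < j)%N ->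
  \sum_(k < n) \sum_(U : {set 'I_n} | (#|U| == u) && (k \notin U))
     ((k == i)%:R - (k == j)%:R) * B i j U =
  \sum_(W : {set 'I_n} | #|W| == u.+1) ((i \in W) && (j \in W))%:R * A W.
Proof.
move=> ij; have ji : j != i by rewrite -val_eqE/= gtn_eqF.
pose S k := \sum_(U : {set 'I_n} | (#|U| == u) && (k \notin U)) B i j U.
transitivity (S i - S j).
  under eq_bigr => k _ do rewrite -mulr_sumr -/(S k) mulrBl.
  rewrite sumrB; congr (_ - _).
    by rewrite (bigD1 i)//= eqxx mul1r big1 ?addr0// => k /negbTE ->; rewrite mul0r.
  by rewrite (bigD1 j)//= eqxx mul1r big1 ?addr0// => k /negbTE ->; rewrite mul0r.
rewrite /S (bigID (fun U : {set 'I_n} => j \in U))/=.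
rewrite [X in _ - X](bigID (fun U : {set 'I_n} => i \in U))/=.
rewrite [X in _ - (_ + X)](eq_bigl (fun U : {set 'I_n} =>
  (#|U| == u) && (i \notin U) && (j \notin U))); last first.
  by move=> U; rewrite andbAC.
rewrite opprD addrACA subrr addr0.
rewrite [X in X - _]big_mkcondr [X in _ - X]big_mkcondr/= !sum_sets_notin.
rewrite [X in X - _]big_mkcondr [X in _ - X]big_mkcondr/= -sumrB.
apply: eq_bigr => W _; rewrite !inE ji (eq_sym i) ji/=.
have [iW|iW] := boolP (i \in W); have [jW|jW] := boolP (j \in W);
  rewrite ?subrr ?mul0r// mul1r.
exact: sink_mult_subdivide.
Qed.

(** Double counting in the sum of [sink_mult_balance] over all [k] outside [U]: each [U] occurs
    [n - u] times, each [W] of size [u + 1] occurs [u + 1] times through its elements, and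
    [u (u + 1) / 2] times through its pairs by [pair_sum]. *)
Lemma elementary_volume_rec u : (u <= n)%N ->
  (n - u)%:R * E u = u.+1%:R * (m.+1%:R + a%:R * u%:R / 2) * E u.+1.
Proof.
move=> un.
have -> : (n - u)%:R * E u =
    \sum_(k < n) \sum_(U : {set 'I_n} | (#|U| == u) && (k \notin U)) A U.
  rewrite (exchange_big_dep (fun U : {set 'I_n} => #|U| == u))/=; last by move=> ? ? _ /andP[].
  rewrite mulr_sumr; apply: eq_bigr => U /eqP cU; rewrite cU eqxx/=.
  rewrite sumr_const -[(n - u)%N](_ : #|~: U| = _) ?mulr_natl; last first.
    by rewrite cardsCs finset.setCK card_ord cU.
  by congr (_ *+ _); apply: eq_card => k; rewrite !inE.
transitivity (\sum_(k < n) (m.+1%:R * \sum_(W : {set 'I_n} | (#|W| == u.+1) && (k \in W)) A W +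
   a%:R * \sum_(i < n) \sum_(j < n | (i < j)%N)
      \sum_(U : {set 'I_n} | (#|U| == u) && (k \notin U)) ((k == i)%:R - (k == j)%:R) * B i j U)).
  apply: eq_bigr => k _.
  under eq_bigr => U /andP[_ kU] do rewrite (sink_mult_balance kU).
  rewrite big_split/=; congr (_ + _); rewrite -mulr_sumr; congr (_ * _).
    rewrite sum_sets_notin; apply: eq_bigr => W /andP[_ kW].
    by rewrite finset.setD1K.
  rewrite exchange_big/=; apply: eq_bigr => i _.
  by rewrite exchange_big/=.
rewrite big_split/= -!mulr_sumr.
have -> : \sum_(k < n) \sum_(W : {set 'I_n} | (#|W| == u.+1) && (k \in W)) A W = u.+1%:R * E u.+1.
  rewrite (exchange_big_dep (fun U : {set 'I_n} => #|U| == u.+1))/=; last by move=> ? ? _ /andP[].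
  rewrite mulr_sumr; apply: eq_bigr => U /eqP cU.
  by rewrite cU eqxx/= sumr_const cU mulr_natl.
rewrite exchange_big/=.
under eq_bigr => i _.
  rewrite exchange_big/=.
  under eq_bigr => j ij.
    rewrite (_ : \sum_(k < n) _ =
      \sum_(W : {set 'I_n} | #|W| == u.+1) ((i \in W) && (j \in W))%:R * A W); last first.
      exact: pair_sum.
    over.
  over.
rewrite /=.
have -> : \sum_(i < n) \sum_(j < n | (i < j)%N)
    \sum_(W : {set 'I_n} | #|W| == u.+1) ((i \in W) && (j \in W))%:R * A W =
    (u.+1 * u)%:R / 2 * E u.+1.
  under eq_bigr => i _ do rewrite exchange_big/=.
  rewrite exchange_big/= mulr_sumr; apply: eq_bigr => W /eqP cW.
  under eq_bigr => i _ do rewrite -mulr_suml.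
  by rewrite -mulr_suml sum_pairs_in cW.
by rewrite natrM; ring.
Qed.

End Aomoto.

Lemma flow_volume_sink_step (n a m : nat) :
  flow_volume n (fun e => if e.2 == n then m else a) =
  (\prod_(u < n) (m.+1%:R + a%:R * u%:R / 2)) *
  flow_volume n (fun e => if e.2 == n then m.+1 else a).
Proof.
pose E := elementary_volume n a m.
have E0 : E 0%N = flow_volume n (fun e => if e.2 == n then m else a).
  rewrite /E /elementary_volume (bigD1 finset.set0)/= ?cards0// big1 ?addr0; last first.
    by move=> U /andP[]; rewrite cards_eq0 => ->.
  congr flow_volume; apply/funext => e; rewrite /sink_mult; case: ifP => // _.
  by rewrite enum_set0 addn0.
have En : E n = flow_volume n (fun e => if e.2 == n then m.+1 else a).
  rewrite /E /elementary_volume (bigD1 finset.setT)/= ?cardsT ?card_ord// big1 ?addr0; last first.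
    move=> U /andP[/eqP cU /eqP[]]; apply/eqP.
    by rewrite eqEcard finset.subsetT cardsT card_ord cU leqnn.
  rewrite /flow_volume; congr rspline; congr flatten; apply/eq_in_map => e.
  rewrite mem_edge_list /sink_mult => /andP[e12 e2n]; congr nseq; case: ifP => // _.
  have e1n := leq_trans e12 e2n; rewrite -(addn1 m); congr addn.
  by rewrite (_ : e.1 = val (Ordinal e1n))// map_f// mem_enum inE.
have P j : (j <= n)%N -> E 0%N * \prod_(u < j) (n - u)%:R =
    (\prod_(u < j) u.+1%:R) * (\prod_(u < j) (m.+1%:R + a%:R * u%:R / 2)) * E j.
  elim: j => [|j IH] jn; first by rewrite !big_ord0 !mulr1 !mul1r.
  rewrite !big_ord_recr/= mulrA IH ?(ltnW jn)//.
  have := elementary_volume_rec a m (ltnW jn); rewrite -/E => h.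
  rewrite mulrAC -mulrA h; ring.
(* The factors [n - u] and [u + 1] have the same nonzero product over [u < n], which cancels. *)
have := P n (leqnn n); rewrite E0 En (reindex_inj rev_ord_inj)/=.
rewrite (eq_bigr (fun u : 'I_n => u.+1%:R)) => [|u _]; last by rewrite subKn.
move=> h; apply: (@mulfI _ (\prod_(u < n) u.+1%:R)); last by rewrite mulrC h mulrA.
by apply/prodf_neq0 => u _; rewrite pnatr_eq0.
Qed.

(** Merging the last vertex with the sink turns the [a] edges from each remaining vertex to it into
    sink edges, which join the implicit one. *)
Lemma flow_volume_contract (n a : nat) :
  flow_volume n.+1 (fun e => if e.2 == n.+1 then 0%N else a) =
  flow_volume n (fun e => if e.2 == n then a else a).
Proof.
rewrite /flow_volume /rspline; set X := multi_list n.+1 _.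
have cX e : count_mem e X = if is_edge n e then a else 0%N.
  rewrite count_multi_list /is_edge; have [_|//] := ltnP e.1 e.2.
  by rewrite /= [(e.2 <= n.+1)%N]leq_eqVlt ltnS; case: eqP => [->|//]; rewrite ltnn.
have XE e : e \in X -> is_edge n e.
  by rewrite -has_pred1 has_count cX; case: ifP.
rewrite spline_contract ?ler01 ?multi_list_edges//; last first.
  by apply/negP => /XE; rewrite /is_edge/= ltnn andbF.
congr fine; apply: perm_spline.
rewrite (_ : map _ X = X); last first.
  rewrite -[RHS]map_id; apply/eq_in_map => e /XE /andP[_ e2n].
  by rewrite (minn_idPl e2n) -surjective_pairing.
by apply: eq_count_perm => e; rewrite cX count_multi_list if_same.
Qed.

Lemma flow_volume0 mu : flow_volume 0 mu = 1.
Proof. by []. Qed.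

End Volume.

(** * The Gamma function *)

Section GammaFunction.
Context (R : realType).
Local Notation mu := (@lebesgue_measure R).
Implicit Types (x t u p : R).

Let Gint x : \bar R :=
  (\int[mu]_(t in `]0%R, +oo[) (t `^ (x - 1) * expR (- t))%:E)%E.

Let mint p : measurable_fun [set: R] (fun t => (t `^ p * expR (- t))%:E).
Proof.
apply/measurable_EFinP; apply: measurable_funM => //.
by apply: measurableT_comp => //; exact: measurable_funN.
Qed.

Lemma integral_expRN_from u :
  (\int[mu]_(t in `[u, +oo[) (expR (- t))%:E = (expR (- u))%:E)%E.
Proof.
have cN : continuous (fun t : R => expR (- t)).
  by move=> t; apply: continuous_comp; [exact: opp_continuous|exact: continuous_expR].
rewrite (@ge0_continuous_FTC2y _ _ (fun t => - expR (- t)) _ 0).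
- by rewrite EFinN oppeK add0e.
- by move=> t _; exact: expR_ge0.
- by apply: continuous_subspaceT.
- by rewrite -oppr0; apply: cvgN; exact: cvgr_expR.
- by move=> t _; exact: ex_derive.
- by apply: cvg_at_right_filter; apply: cvgN; exact: cN.
- by move=> t _; rewrite derive1E derive_val /GRing.scale/=; ring.
Qed.

Lemma powR_cvg_right0 p : 0 <= p -> t `^ p @[t --> (0 : R)^'+] --> (0 : R) `^ p.
Proof.
rewrite le_eqVlt => /predU1P[<-|p0].
  under eq_fun do rewrite powRr0.
  by rewrite powRr0; exact: cvg_cst.
by rewrite powR0 ?gt_eqF//; exact: powR_cvg0.
Qed.

Lemma powR_continuous p t : 0 < t -> {for t, continuous (fun u : R => u `^ p)}.
Proof.
move=> t0; apply: differentiable_continuous; apply/derivable1_diffP.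
by apply: derivable_powR; rewrite in_itv/= t0.
Qed.

Lemma integral_powR_from0 x t : 1 <= x -> 0 < t ->
  (\int[mu]_(u in `[0%R, t]) (x * u `^ (x - 1))%:E = (t `^ x)%:E)%E.
Proof.
move=> x1 t0.
rewrite (@continuous_FTC2 _ _ (fun u => u `^ x))//.
- by rewrite powR0 ?sube0// gt_eqF// (lt_le_trans ltr01).
- apply/continuous_within_itvP => //; split.
  + move=> u; rewrite in_itv/= => /andP[u0 _].
    by apply: cvgM; [exact: cvg_cst|exact: powR_continuous].
  + apply: cvgM; [exact: cvg_cst|apply: powR_cvg_right0].
    by rewrite subr_ge0.
  + apply: cvgM; [exact: cvg_cst|].
    by apply: cvg_at_left_filter; exact: powR_continuous.
- split.
  + by move=> u; rewrite in_itv/= => /andP[u0 _]; apply: derivable_powR; rewrite in_itv/= u0.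
  + by apply: powR_cvg_right0; rewrite (le_trans ler01).
  + by apply: cvg_at_left_filter; exact: powR_continuous.
- by move=> u; rewrite in_itv/= => /andP[u0 _]; rewrite powR_derive1// in_itv/= u0.
Qed.

(** Tonelli replaces integration by parts: [t^x] is the integral of [x u^(x-1)] over [[0, t]], and
    the integral of [exp(-t)] over [[u, +oo[] is [exp(-u)]. The bound [1 <= x] keeps [u^(x-1)]
    continuous at 0. *)
Let GintS x : 1 <= x -> (Gint (x + 1) = x%:E * Gint x)%E.
Proof.
move=> x1; have x0 : 0 <= x by rewrite (le_trans ler01).
pose f t u : \bar R := (if (0 < u)%R && (u <= t)%R then
  (x * u `^ (x - 1) * expR (- t))%:E else 0)%E.
have f0 t u : (0 <= f t u)%E.
  by rewrite /f; case: ifP => // _; rewrite lee_fin !mulr_ge0 ?powR_ge0 ?expR_ge0.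
have mf : measurable_fun [set: R * R] (fun z => f z.1 z.2).
  apply: measurable_fun_ifT => //.
    by apply: measurable_and; [exact: measurable_fun_ltr|exact: measurable_fun_ler].
  apply/measurable_EFinP; apply: measurable_funM.
    apply: measurable_funM => //.
    exact: (measurableT_comp (measurable_powR _)).
  apply: measurableT_comp => //; exact: measurable_funN.
transitivity (\int[mu]_t \int[mu]_u f t u)%E.
  rewrite /Gint [LHS]integral_mkcond; apply: eq_integral => t _.
  rewrite patchE mem_setE in_itv/= andbT addrK.
  have [t0|t0] := ltP 0 t; last first.
    rewrite integral0_eq// => u _; rewrite /f; case: ifP => // /andP[u0 ut].
    by have := lt_le_trans u0 (le_trans ut t0); rewrite ltxx.
  transitivity (\int[mu]_(u in `]0%R, t]) ((expR (- t))%:E * (x * u `^ (x - 1))%:E))%E.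
    rewrite ge0_integralZl ?lee_fin ?expR_ge0//.
    - rewrite integral_itv_obnd_cbnd; last first.
        by apply/measurable_EFinP; apply: measurable_funM => //; apply: (@measurable_funS _ _ _ _ setT).
      by rewrite integral_powR_from0// -EFinM mulrC.
    - by apply/measurable_EFinP; apply: measurable_funM => //; apply: (@measurable_funS _ _ _ _ setT).
    - by move=> u _; rewrite lee_fin mulr_ge0// powR_ge0.
  rewrite [LHS]integral_mkcond; apply: eq_integral => u _.
  rewrite patchE mem_setE in_itv/= /f; case: ifP => // _.
  by rewrite -EFinM mulrC.
rewrite tonelli_lebesgue//.
rewrite /Gint -ge0_integralZl//; last 2 first.
- by apply: (@measurable_funS _ _ _ _ setT) => //; exact: mint.
- by move=> t _; rewrite lee_fin mulr_ge0 ?powR_ge0 ?expR_ge0.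
rewrite [RHS]integral_mkcond; apply: eq_integral => u _.
rewrite patchE mem_setE in_itv/= andbT /f.
have [u0|u0] := ltP 0 u; last by rewrite integral0_eq.
transitivity (\int[mu]_(t in `[u, +oo[) ((x * u `^ (x - 1))%:E * (expR (- t))%:E))%E.
  rewrite [RHS]integral_mkcond; apply: eq_integral => t _.
  by rewrite patchE mem_setE in_itv/= andbT -EFinM.
rewrite ge0_integralZl//.
- by rewrite integral_expRN_from -!EFinM mulrA.
- apply/measurable_EFinP; apply: (@measurable_funS _ _ _ _ setT) => //.
  by apply: measurableT_comp => //; exact: measurable_funN.
- by rewrite lee_fin mulr_ge0// powR_ge0.
Qed.

Let Gint1 : Gint 1 = 1%E.
Proof.
rewrite /Gint subrr.
under eq_integral do rewrite powRr0 mul1r.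
rewrite integral_itv_obnd_cbnd.
  by rewrite integral_expRN_from oppr0 expR0.
apply/measurable_EFinP; apply: (@measurable_funS _ _ _ _ setT) => //.
by apply: measurableT_comp => //; exact: measurable_funN.
Qed.

Let Gint_nat n : Gint n.+1%:R = n`!%:R%:E.
Proof.
elim: n => [|n IH]; first exact: Gint1.
rewrite -[n.+2]addn1 natrD GintS ?ler1n// IH -EFinM -natrM factS.
by [].
Qed.

Let Gint_fin x : 1 <= x -> Gint x \is a fin_num.
Proof.
move=> x1; have x0 : 0 <= x - 1 by rewrite subr_ge0.
have G0 y : (0 <= Gint y)%E.
  by apply: integral_ge0 => t _; rewrite lee_fin mulr_ge0 ?powR_ge0 ?expR_ge0.
rewrite ge0_fin_numE//.
pose n := Num.bound (x - 1).
(* The power [t^(x-1)] is at most 1 for [t <= 1] and at most [t^n] beyond, so two integrals with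
   known factorial values dominate. *)
apply: (@le_lt_trans _ _ (Gint 1 + Gint n.+1%:R)%E); last first.
  by rewrite Gint1 Gint_nat -EFinD ltry.
have mD y : measurable_fun (`]0%R, +oo[ : set R) (fun t => (t `^ (y - 1) * expR (- t))%:E).
  by apply: (@measurable_funS _ _ _ _ setT) => //; exact: mint.
rewrite /Gint -ge0_integralD//.
- apply: ge0_le_integral => //.
  + by move=> t _; rewrite lee_fin mulr_ge0 ?powR_ge0 ?expR_ge0.
  + exact: mD.
  + exact: (emeasurable_funD (mD _) (mD _)).
  + move=> t; rewrite /= in_itv/= andbT => t0.
    rewrite lee_fin -mulrDl ler_wpM2r ?expR_ge0// subrr powRr0 -natr1 addrK.
    have [t1|t1] := leP t 1.
      apply: (@le_trans _ _ 1); last by rewrite lerDl powR_ge0.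
      apply: (@le_trans _ _ (1 `^ (x - 1))); last by rewrite powR1.
      by rewrite ge0_ler_powR// nnegrE ltW.
    apply: (@le_trans _ _ (t `^ n%:R)); last by rewrite lerDr.
    rewrite ler_powR ?(ltW t1)//.
    by rewrite ltW// /n archi_boundP.
- by move=> t _; rewrite lee_fin mulr_ge0 ?powR_ge0 ?expR_ge0.
- exact: mD.
- by move=> t _; rewrite lee_fin mulr_ge0 ?powR_ge0 ?expR_ge0.
- exact: mD.
Qed.

Lemma GammaS x : 1 <= x -> Gamma (x + 1) = x * Gamma x.
Proof.
by move=> x1; rewrite /Gamma -/(Gint _) GintS// fineM// Gint_fin.
Qed.

Lemma Gamma1 : Gamma (1 : R) = 1.
Proof. by rewrite /Gamma -/(Gint _) Gint1. Qed.

Lemma Gamma_gt0 x : 1 <= x -> 0 < Gamma x.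
Proof.
move=> x1; rewrite /Gamma -/(Gint x) fine_gt0//.
rewrite -[X in _ && X]ge0_fin_numE ?Gint_fin ?andbT//; last first.
  by apply: integral_ge0 => t _; rewrite lee_fin mulr_ge0 ?powR_ge0 ?expR_ge0.
apply: (@lt_le_trans _ _ (\int[mu]_(t in `[1%R, +oo[) (expR (- t))%:E)%E).
  by rewrite integral_expRN_from lte_fin expR_gt0.
apply: (@le_trans _ _ (\int[mu]_(t in `[1%R, +oo[) (t `^ (x - 1) * expR (- t))%:E)%E).
  apply: ge0_le_integral => //.
  - apply/measurable_EFinP; apply: (@measurable_funS _ _ _ _ setT) => //.
    by apply: measurableT_comp => //; exact: measurable_funN.
  - by apply: (@measurable_funS _ _ _ _ setT) => //; exact: mint.
  - move=> t; rewrite /= in_itv/= andbT => t1.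
    rewrite lee_fin ler_peMl ?expR_ge0//.
    by rewrite -[leLHS](powRr0 t) ler_powR// subr_ge0.
apply: ge0_subset_integral => //.
- by apply: (@measurable_funS _ _ _ _ setT) => //; exact: mint.
- by move=> t _; rewrite lee_fin mulr_ge0 ?powR_ge0 ?expR_ge0.
- by move=> t /=; rewrite !in_itv/= !andbT; exact: lt_le_trans.
Qed.

(* Substituting [2 t] for [t] shows that the integral of [1 / t] over [0, 1]
   does not change when its part over [1/2, 1] is removed. *)
Lemma Gamma0 : Gamma (0 : R) = 0.
Proof.
pose F t : \bar R := (if (0 < t)%R && (t <= 1)%R then (t `^ (-1))%:E else 0)%E.
have F0 t : (0 <= F t)%E.
  by rewrite /F; case: ifP => // _; rewrite lee_fin powR_ge0.
have mF : measurable_fun [set: R] F.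
  apply: measurable_fun_ifT => //.
    by apply: measurable_and; [exact: measurable_fun_ltr|exact: measurable_fun_ler].
  exact/measurable_EFinP.
pose J := (\int[mu]_t F t)%E.
have J0 : (0 <= J)%E by exact: integral_ge0.
have Joo : J = +oo%E.
  apply/eqP; apply: contraT; rewrite -ltey -ge0_fin_numE// => Jfin.
  suff : (J + 2^-1%:E <= J)%E.
    by rewrite -(fineK Jfin) -EFinD lee_fin gerDl leNgt invr_gt0 ltr0n.
  have mF2 : measurable_fun [set: R] (fun t => F (t * 2)%R).
    by apply: (measurableT_comp mF); exact: measurable_funM.
  (* The integrand is below [F]: on []0, 1/2]] the first term is [1/t], and on []1/2, 1]] the second
     is [1 <= 1/t]. *)
  have -> : (J + 2^-1%:E = \int[mu]_t (2%:E * F (t * 2)%R +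
      (\1_(`]2^-1, 1]%classic : set R) t)%:E))%E.
    rewrite ge0_integralD//.
    - rewrite ge0_integralZl// ge0_integral_scale// muleA -EFinM.
      rewrite ger0_norm// mulfV// mul1e integral_indic//= setIT lebesgue_measure_itv/=.
      rewrite lte_fin invf_lt1 ?ltr1n// -EFinB; congr (_ + _%:E)%E.
      by field.
    - by move=> t _; rewrite mule_ge0.
    - exact: measurable_funeM.
    - by apply/measurable_EFinP; exact: measurable_indic.
  apply: ge0_le_integral => //.
  - by move=> t _; rewrite adde_ge0 ?mule_ge0.
  - apply: emeasurable_funD; first exact: measurable_funeM.
    by apply/measurable_EFinP; exact: measurable_indic.
  - move=> t _; rewrite indicE mem_setE in_itv/= /F pmulr_lgt0//.
    have [t0|t0] := ltP 0 t; last first.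
      by rewrite /= mule0 add0e (ltNge _ t) (le_trans t0) ?invr_ge0.
    have -> : (t * 2 <= 1) = (t <= 2^-1) by rewrite -ler_pdivlMr// mul1r.
    case: (leP t 2^-1) => t2 /=.
      rewrite (le_trans t2) ?invf_le1 ?ler1n// adde0 -EFinM lee_fin.
      by rewrite !powR_inv1 ?mulr_ge0 ?(ltW t0)// invfM mulrCA mulfV// mulr1.
    rewrite mule0 add0e; case: ifP => // t1.
    by rewrite lee_fin powR_inv1 ?(ltW t0)// invf_ge1.
rewrite /Gamma (_ : (\int[mu]_(t in _) _)%E = +oo%E)//.
apply/eqP; rewrite -leye_eq.
have <- : ((expR (-1))%:E * J = +oo)%E by rewrite Joo gt0_muley// lte_fin expR_gt0.
rewrite -ge0_integralZl ?lee_fin ?expR_ge0//.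
rewrite [leRHS]integral_mkcond; apply: ge0_le_integral => //.
- by move=> t _; rewrite mule_ge0 ?lee_fin ?expR_ge0.
- exact: measurable_funeM.
- apply/(measurable_restrictT _ _).1 => //.
  by apply: (@measurable_funS _ _ _ _ setT) => //; exact: mint.
- move=> t _; rewrite patchE mem_setE in_itv/= andbT /F.
  have [t0|t0] := ltP 0 t; last by rewrite mule0.
  case: ifP => t1; last by rewrite mule0 lee_fin mulr_ge0 ?powR_ge0 ?expR_ge0.
  rewrite -EFinM lee_fin sub0r mulrC ler_wpM2l ?powR_ge0//.
  by rewrite ler_expR lerN2.
Qed.

End GammaFunction.

(** * Linear changes of variables *)

Section IteratedIntegral.
Context (R : realType).
Local Notation mu := (@lebesgue_measure R).

Fixpoint integral_rV (d : nat) : ('rV[R]_d -> \bar R) -> \bar R :=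
  match d with
  | 0 => fun F => F 0
  | d'.+1 => fun F : 'rV[R]_(1 + d') -> \bar R =>
      (\int[mu]_x integral_rV (fun y : 'rV[R]_d' => F (row_mx x%:M y)))%E
  end.

Lemma lebesgue_rVE d (A : set 'rV[R]_d) :
  lebesgue_rV A = integral_rV (fun y => (\1_A y)%:E).
Proof.
elim: d A => [//|d IH] A /=.
by apply: eq_integral => x _; rewrite IH; congr integral_rV.
Qed.

(* Measurability of a function of [x] and of a row vector [y], for the
   sigma-algebra generated by the entries of [y]. *)
Definition coord_measurable d0 (T : measurableType d0) d (F : T -> 'rV[R]_d -> \bar R) :=
  forall d1 (T1 : measurableType d1) (h : T1 -> T) (g : T1 -> 'rV[R]_d),
    measurable_fun setT h -> (forall j, measurable_fun setT (fun x => g x ord0 j)) ->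
    measurable_fun setT (fun x => F (h x) (g x)).

Local Open Scope ereal_scope.

Lemma integral_rV_ge0 d (F : 'rV[R]_d -> \bar R) : (forall y, 0 <= F y) ->
  0 <= integral_rV F.
Proof.
elim: d F => [|d IH] F F0 /=; first exact: F0.
by apply: integral_ge0 => x _; apply: IH.
Qed.

Lemma row_mx_measurable d0 (T : measurableType d0) d (x : T -> R) (g : T -> 'rV[R]_d) :
  measurable_fun setT x -> (forall j, measurable_fun setT (fun t => g t ord0 j)) ->
  forall j, measurable_fun [set: T] (fun t => row_mx (x t)%:M (g t) ord0 j).
Proof.
move=> mx mg j; case: (splitP j) => k jk.
  have -> : j = lshift d k by apply: val_inj.
  rewrite (_ : (fun t => _) = x)//.
  by apply/funext => t; rewrite row_mxEl (ord1 k) mxE.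
have -> : j = rshift 1 k by apply: val_inj.
under eq_fun do rewrite row_mxEr.
exact: mg.
Qed.

Lemma coord_measurable_row d0 (T : measurableType d0) d (F : T -> 'rV[R]_(1 + d) -> \bar R) :
  coord_measurable F ->
  coord_measurable (fun (z : T * R) (y : 'rV[R]_d) => F z.1 (row_mx z.2%:M y)).
Proof.
move=> mF d1 T1 h g mh mg; apply: mF; first exact: (measurableT_comp measurable_fst mh).
by apply: row_mx_measurable => //; exact: (measurableT_comp measurable_snd mh).
Qed.

Lemma measurable_integral_rV d0 (T : measurableType d0) d (F : T -> 'rV[R]_d -> \bar R) :
  coord_measurable F -> (forall x y, 0 <= F x y) ->
  measurable_fun [set: T] (fun x => integral_rV (F x)).
Proof.
elim: d d0 T F => [|d IH] d0 T F mF F0 /=.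
  by apply: mF => // j; exact: measurable_cst.
apply: measurable_integral_lebesgue.
  apply: (IH _ _ (fun (z : T * R) (y : 'rV[R]_d) => F z.1 (row_mx z.2%:M y))) => //.
  exact: coord_measurable_row.
by move=> x y; exact: integral_rV_ge0.
Qed.

Lemma eq_integral_rV d (F G : 'rV[R]_d -> \bar R) : F =1 G -> integral_rV F = integral_rV G.
Proof. by move=> /funext ->. Qed.

(** The parameter space [T] is arbitrary so that the induction can absorb the first coordinate into
    the parameter; each step is one use of Tonelli. *)
Lemma integral_rV_exchange d0 (T : measurableType d0) d (F : T -> R -> 'rV[R]_d -> \bar R) x :
  coord_measurable (fun z : T * R => F z.1 z.2) -> (forall x t y, 0 <= F x t y) ->
  \int[mu]_t integral_rV (F x t) = integral_rV (fun y => \int[mu]_t F x t y).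
Proof.
elim: d d0 T F x => [//|d IH] d0 T F x mF F0 /=.
pose G (z : T * R) (t : R) (y : 'rV[R]_d) := F z.1 t (row_mx z.2%:M y).
have mG : coord_measurable (fun z : (T * R) * R => G z.1 z.2).
  move=> d1 T1 h g mh mg; rewrite /G/=.
  have mh1 := measurableT_comp measurable_fst mh.
  apply: (mF _ _ (fun t => ((h t).1.1, (h t).2))).
    apply/measurable_fun_pairP; split.
      exact: (measurableT_comp measurable_fst mh1).
    exact: (measurableT_comp measurable_snd mh).
  apply: row_mx_measurable => //.
  exact: (measurableT_comp measurable_snd mh1).
rewrite (tonelli_lebesgue (f := fun t s => integral_rV (fun y => F x t (row_mx s%:M y)))); last 2 first.
- apply: (measurable_integral_rV (F := fun z : R * R => fun y => F x z.1 (row_mx z.2%:M y))) => //.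
  move=> d1 T1 h g mh mg; apply: (mF _ _ (fun t => (x, (h t).1))).
    apply/measurable_fun_pairP; split; first exact: measurable_cst.
    exact: (measurableT_comp measurable_fst mh).
  by apply: row_mx_measurable => //; exact: (measurableT_comp measurable_snd mh).
- by move=> t s; exact: integral_rV_ge0.
apply: eq_integral => s _.
exact: (IH _ _ G (x, s) mG (fun _ _ _ => F0 _ _ _)).
Qed.

Definition rV_measurable d (F : 'rV[R]_d -> \bar R) :=
  coord_measurable (fun _ : unit => F).

Lemma rV_measurable_row d (F : 'rV[R]_(1 + d) -> \bar R) :
  rV_measurable F -> coord_measurable (fun (x : R) (y : 'rV[R]_d) => F (row_mx x%:M y)).
Proof.
move=> mF d1 T1 h g mh mg; apply: (mF _ _ (fun=> tt)) => //.
exact: row_mx_measurable.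
Qed.

Lemma rV_measurable_slice d (F : 'rV[R]_(1 + d) -> \bar R) x :
  rV_measurable F -> rV_measurable (fun y : 'rV[R]_d => F (row_mx x%:M y)).
Proof.
move=> mF d1 T1 h g mh mg; apply: (mF _ _ (fun=> tt)) => //.
exact: row_mx_measurable.
Qed.

Lemma affine_measurable d0 (T : measurableType d0) d e (A : 'M[R]_(d, e)) (u : 'rV[R]_e)
    (g : T -> 'rV[R]_d) : (forall j, measurable_fun setT (fun t => g t ord0 j)) ->
  forall j, measurable_fun [set: T] (fun t => (g t *m A + u)%R ord0 j).
Proof.
move=> mg j; under eq_fun do rewrite !mxE.
apply: measurable_funD => //; apply: measurable_sum => k.
exact: measurable_funM.
Qed.

Lemma rV_measurable_affine d e (A : 'M[R]_(d, e)) (u : 'rV[R]_e) (F : 'rV[R]_e -> \bar R) :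
  rV_measurable F -> rV_measurable (fun y => F (y *m A + u)%R).
Proof.
move=> mF d1 T1 h g mh mg; apply: (mF _ _ (fun=> tt)) => //.
exact: affine_measurable.
Qed.

Lemma integral_rV_shift d (F : 'rV[R]_d -> \bar R) (u : 'rV[R]_d) :
  rV_measurable F -> (forall y, 0 <= F y) ->
  integral_rV (fun y => F (y + u)%R) = integral_rV F.
Proof.
elim: d F u => [|d IH] F u mF F0 /=; first by congr F; apply/matrixP => i [].
rewrite -(@hsubmxK _ 1 1 d u); set r := lsubmx _; set u' := rsubmx _.
transitivity (\int[mu]_x (integral_rV (fun y : 'rV[R]_d => F (row_mx (x + r ord0 ord0)%R%:M y)))).
  apply: eq_integral => x _.
  rewrite -[RHS](IH _ u')//; last exact: rV_measurable_slice.
  apply: eq_integral_rV => y; congr F.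
  apply/rowP => k; rewrite !mxE; case: splitP => l _; rewrite !mxE//.
  by rewrite (ord1 l) !mulr1n.
apply: (ge0_integral_shift (F := fun x => integral_rV (fun y : 'rV[R]_d => F (row_mx x%:M y)))).
  by apply: measurable_integral_rV => //; exact: rV_measurable_row.
by move=> x; exact: integral_rV_ge0.
Qed.

Definition scales_volume d (A : 'M[R]_d) := forall F : 'rV[R]_d -> \bar R,
  rV_measurable F -> (forall y, 0 <= F y) ->
  integral_rV (fun y => F (y *m A)) = (`|\det A|^-1)%:E * integral_rV F.

Lemma scales_volumeM d (A B : 'M[R]_d) :
  scales_volume A -> scales_volume B -> scales_volume (A *m B).
Proof.
move=> sA sB F mF F0.
under eq_integral_rV do rewrite mulmxA.
rewrite (sA (fun y => F (y *m B))).
- by rewrite sB// muleA -EFinM det_mulmx normrM invfM.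
- move=> d1 T1 h g mh mg; have := rV_measurable_affine B 0%R mF mh mg.
  by under eq_fun do rewrite addr0.
- by [].
Qed.

(** For a fixed first coordinate [x], the others undergo [B] and a translation by [x *: r]; then [x]
    itself is scaled by [a]. *)
Lemma scales_volume_block_upper d (a : R) (r : 'rV[R]_d) (B : 'M[R]_d) : a != 0%R ->
  scales_volume B -> scales_volume (block_mx a%:M r 0 B : 'M[R]_(1 + d)).
Proof.
move=> a0 sB F mF F0 /=.
have mB x : rV_measurable (fun y : 'rV[R]_d => F (row_mx x%:M y)) by exact: rV_measurable_slice.
pose H x := integral_rV (fun y : 'rV[R]_d => F (row_mx x%:M y)).
have H0 x : 0 <= H x by exact: integral_rV_ge0.
have mH : measurable_fun [set: R] H.
  by apply: measurable_integral_rV => //; exact: rV_measurable_row.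
transitivity (\int[mu]_x ((`|\det B|^-1)%:E * H (x * a)%R)).
  apply: eq_integral => x _.
  transitivity (integral_rV (fun y : 'rV[R]_d => F (row_mx (x * a)%R%:M (y *m B + x *: r)%R))).
    apply: eq_integral_rV => y; congr F.
    by rewrite mul_row_block mulmx0 addr0 mul_scalar_mx scale_scalar_mx mul_scalar_mx addrC.
  pose F' y := F (row_mx (x * a)%R%:M (y + x *: r)%R).
  have mF' : rV_measurable F'.
    move=> d1 T1 h g mh mg; have := rV_measurable_affine 1%:M (x *: r) (mB (x * a)%R) mh mg.
    by under eq_fun do rewrite mulmx1.
  rewrite (sB F' mF' (fun _ => F0 _)); congr (_ * _).
  by rewrite /F' (integral_rV_shift _ (F := fun y => F (row_mx (x * a)%R%:M y))).
rewrite ge0_integralZl ?lee_fin//; last first.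
  by apply: (measurableT_comp mH); exact: measurable_funM.
rewrite ge0_integral_scale// muleA -EFinM det_ublock det_scalar1 normrM invfM.
by rewrite mulrC.
Qed.

(** The first coordinate is translated by an amount depending on the others, so its integral must be
    moved innermost. *)
Lemma scales_volume_shear d (v : 'cV[R]_d) :
  scales_volume (block_mx 1%:M 0 v 1%:M : 'M[R]_(1 + d)).
Proof.
move=> F mF F0 /=; rewrite det_lblock !det1 mulr1 normr1 invr1 mul1e.
pose G (z : unit) (x : R) (y : 'rV[R]_d) := F (row_mx (x + (y *m v) ord0 ord0)%R%:M y).
have mG : coord_measurable (fun z : unit * R => G z.1 z.2).
  move=> d1 T1 h g mh mg; apply: (mF _ _ (fun=> tt)) => //.
  apply: row_mx_measurable => //; apply: measurable_funD.
    exact: (measurableT_comp measurable_snd mh).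
  have := affine_measurable v 0%R mg ord0.
  by under eq_fun do rewrite addr0.
transitivity (\int[mu]_x integral_rV (G tt x)).
  apply: eq_integral => x _; apply: eq_integral_rV => y; congr F.
  by rewrite mul_row_block mulmx0 add0r !mulmx1 [y *m v in LHS]mx11_scalar raddfD.
rewrite (integral_rV_exchange tt mG (fun _ _ _ => F0 _)).
pose G' (z : unit) (x : R) (y : 'rV[R]_d) := F (row_mx x%:M y).
have mG' : coord_measurable (fun z : unit * R => G' z.1 z.2).
  move=> d1 T1 h g mh mg; apply: (mF _ _ (fun=> tt)) => //.
  by apply: row_mx_measurable => //; exact: (measurableT_comp measurable_snd mh).
rewrite [RHS](integral_rV_exchange tt mG' (fun _ _ _ => F0 _)).
apply: eq_integral_rV => y.
apply: (ge0_integral_shift (F := fun x => F (row_mx x%:M y))) => //.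
apply: (mF _ _ (fun=> tt)) => //.
by apply: row_mx_measurable => // j; exact: measurable_cst.
Qed.

Lemma scales_volume1 d : scales_volume (1%:M : 'M[R]_d).
Proof.
move=> F mF F0; rewrite det1 normr1 invr1 mul1e.
by apply: eq_integral_rV => y; rewrite mulmx1.
Qed.

(* Gaussian elimination: a shear makes the corner entry nonzero, and two
   further block-triangular factors reduce to a Schur complement. *)
Lemma scales_volume_unitmx d (A : 'M[R]_d) : A \in unitmx -> scales_volume A.
Proof.
elim: d A => [|d IH] A uA.
  move=> F mF F0 /=; rewrite det_mx00 normr1 invr1 mul1e; congr F.
  by apply/matrixP => i [].
have corner (a : R) r c B : a != 0%R ->
    (block_mx a%:M r c B : 'M[R]_(1 + d)) \in unitmx ->
    scales_volume (block_mx a%:M r c B : 'M[R]_(1 + d)).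
  move=> a0 uM; pose S := (B - (a^-1 *: c) *m r)%R.
  have E : block_mx a%:M r c B = block_mx 1%:M 0 (a^-1 *: c) 1%:M *m block_mx a%:M r 0 S.
    rewrite mulmx_block !mul0mx !mulmx0 !mul1mx !addr0 mul_mx_scalar scalerA mulfV// scale1r.
    by rewrite /S addrC subrK.
  rewrite E; apply: scales_volumeM; first exact: scales_volume_shear.
  apply: scales_volume_block_upper => //; apply: IH.
  by move: uM; rewrite E !unitmxE det_mulmx det_lblock det_ublock !det1 !mul1r det_scalar1 unitrM => /andP[].
rewrite -(@submxK _ 1 d 1 d A) in uA *.
set r := ursubmx _ in uA *; set c := dlsubmx _ in uA *; set B := drsubmx _ in uA *.
rewrite [ulsubmx _]mx11_scalar in uA *; set a := ulsubmx _ _ _ in uA *.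
have [a0|] := eqVneq a 0%R; last by move=> a0; exact: corner.
have /existsP[i ci] : [exists i, c i ord0 != 0%R].
  apply: contraT; rewrite negb_exists => /forallP c0.
  have cE : c = 0%R.
    by apply/colP => i; apply/eqP; rewrite [X in _ == X]mxE; apply/negPn; exact: c0.
  move: uA; rewrite a0 cE unitmxE.
  have -> : \det (block_mx 0%:M r 0 B) = 0%R :> R.
    by apply: etrans (det_ublock _ _ _) _; rewrite det_scalar1 mul0r.
  by rewrite unitr0.
(* [T x] adds [x] times row [i] of the lower blocks to the first row: [T 1] brings the nonzero [c i]
   to the corner and [T (-1)] undoes it. *)
pose T (x : R) := block_mx 1%:M (x *: delta_mx ord0 i : 'rV[R]_d) 0 1%:M : 'M[R]_(1 + d).
have sT x : scales_volume (T x).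
  by apply: scales_volume_block_upper; [exact: oner_neq0|exact: scales_volume1].
have -> : block_mx a%:M r c B = T (-1)%R *m (T 1%R *m block_mx a%:M r c B).
  rewrite mulmxA /T mulmx_block !mulmx0 !mul0mx !mul1mx !mulmx1 !addr0 add0r.
  by rewrite scaleN1r scale1r subrr -scalar_mx_block mul1mx.
apply: scales_volumeM => //.
have TE : T 1%R *m block_mx a%:M r c B =
    block_mx (c i ord0)%:M (r + row i B)%R c B.
  rewrite /T mulmx_block !mul0mx !mul1mx !add0r scale1r -!rowE a0.
  by rewrite raddf0 add0r [row i c]mx11_scalar mxE.
rewrite TE; apply: corner => //; rewrite -TE unitmx_mul uA andbT.
by rewrite unitmxE det_ublock !det1 mulr1 unitr1.
Qed.

End IteratedIntegral.

(** * Independence of the smallest simplex *)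

Section Gram.
Context (R : realType).

Lemma row_sqnorm_gt0 N (x : 'rV[R]_N) : x != 0 -> 0 < (x *m x^T) ord0 ord0.
Proof.
move=> x0; rewrite mxE lt_neqAle sumr_ge0 => [|j _]; last by rewrite mxE -expr2 sqr_ge0.
rewrite andbT eq_sym; apply: contra x0 => /eqP s0.
apply/eqP/rowP => j; rewrite mxE; apply/eqP; rewrite -sqrf_eq0 expr2.
have H k : true -> 0 <= x ord0 k * x^T k ord0 by rewrite mxE -expr2 sqr_ge0.
by have := psumr_eq0P H s0 isT (i := j); rewrite mxE => ->.
Qed.

(** One Gram-Schmidt step: subtracting from the other rows their components along the first has
    determinant 1 and makes the Gram matrix block diagonal. *)
Lemma det_gram_gt0 d N (E : 'M[R]_(d, N)) : row_free E -> 0 < \det (E *m E^T).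
Proof.
elim: d E => [|d IH]; first by move=> E _; rewrite det_mx00.
change (forall E : 'M[R]_(1 + d, N), row_free E -> 0 < \det (E *m E^T)).
move=> E Efree; rewrite -(@vsubmxK _ 1 d N E) in Efree *.
set e := usubmx _ in Efree *; set F := dsubmx _ in Efree *.
have e0 : e != 0.
  apply/eqP => e0; have := @row_free_inj _ 1 _ _ _ Efree (row_mx 1%:M 0 : 'rV[R]_(1 + d)) 0.
  rewrite /= mul0mx mul_row_col e0 mulmx0 mul0mx addr0 => /(_ erefl)/rowP/(_ (lshift d ord0)).
  by rewrite row_mxEl !mxE eqxx => /eqP; rewrite oner_eq0.
set a := (e *m e^T) ord0 ord0; have a0 : 0 < a by exact: row_sqnorm_gt0.
have eeT : e *m e^T = a%:M by rewrite [LHS]mx11_scalar.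
pose L : 'M[R]_(1 + d) := block_mx 1%:M 0 (- (a^-1 *: (F *m e^T))) 1%:M.
have detL : \det L = 1 by rewrite det_lblock !det1 mulr1.
pose G := F - (a^-1 *: (F *m e^T)) *m e.
have LE : L *m col_mx e F = col_mx e G.
  by rewrite mul_block_col mul0mx !mul1mx addr0 mulNmx addrC.
have Gfree : row_free G.
  apply: inj_row_free => x xG.
  have : row_mx 0 x *m (L *m col_mx e F) = 0.
    by rewrite LE mul_row_col mul0mx add0r.
  rewrite mulmxA -[RHS](mul0mx _ (col_mx e F)) => /(row_free_inj Efree).
  rewrite mul_row_block !mul0mx !mulmx1 !add0r => /(congr1 rsubmx).
  by rewrite row_mxKr raddf0.
have GeT : G *m e^T = 0.
  by rewrite mulmxBl -mulmxA eeT mul_mx_scalar scalerA mulfV ?gt_eqF// scale1r subrr.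
have eGT : e *m G^T = 0 by rewrite -[LHS]trmxK trmx_mul trmxK GeT trmx0.
have : \det ((L *m col_mx e F) *m (L *m col_mx e F)^T) = a * \det (G *m G^T).
  by rewrite LE tr_col_mx mul_col_row GeT eGT det_ublock eeT det_scalar1.
rewrite trmx_mul mulmxA -[L *m _ *m _]mulmxA !det_mulmx det_tr detL mul1r mulr1 => ->.
by rewrite mulr_gt0// IH.
Qed.

End Gram.

Section NormalizedVolume.
Context (R : realType).

Lemma sub_affine_span N (P : set 'rV[R]_N) : P `<=` affine_span P.
Proof.
move=> x Px; exists 1%N, (fun=> 1), (fun=> x).
by split; rewrite ?big_ord1 ?scale1r.
Qed.

Lemma affine_span_range d N (v : 'I_d.+1 -> 'rV[R]_N) x :
  affine_span (range v) x <-> exists t, x = simplex_chart v t.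
Proof.
split=> [[k [c [p [pv c1 ->]]]]|[t ->]].
  have /choice[f fE] : forall i, exists j, v j = p i by move=> i; case: (pv i) => j _ <-; exists j.
  have /choice[g gE] : forall j, exists t : 'rV[R]_d, v j = simplex_chart v t.
    move=> j; case: (unliftP ord0 j) => [i|] ->.
      exists (delta_mx ord0 i); rewrite /simplex_chart -rowE.
      by apply/rowP => l; rewrite !mxE addrC subrK.
    by exists 0; rewrite /simplex_chart mul0mx addr0.
  exists (\sum_i c i *: g (f i)); rewrite /simplex_chart mulmx_suml.
  rewrite -[X in X + _]scale1r -c1 scaler_suml -big_split/=; apply: eq_bigr => i _.
  by rewrite -fE [in LHS]gE /simplex_chart scalerDr scalemxAl.
exists d.+1, (fun i => if unlift ord0 i is Some j then t ord0 j else 1 - \sum_j t ord0 j), v; split.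
- by move=> i; exists i.
- rewrite big_ord_recl unlift_none; under [X in _ + X]eq_bigr do rewrite liftK.
  by rewrite subrK.
- rewrite big_ord_recl unlift_none; under [X in _ = _ + X]eq_bigr do rewrite liftK.
  rewrite /simplex_chart scalerBl scale1r -addrA; congr (_ + _).
  rewrite mulmx_sum_row scaler_suml -sumrN -big_split/=.
  by apply: eq_bigr => i _; rewrite rowK scalerBr addrC.
Qed.

Lemma edge_mx_factor d e N (v : 'I_d.+1 -> 'rV[R]_N) (w : 'I_e.+1 -> 'rV[R]_N) :
  (forall i, affine_span (range v) (w i)) ->
  exists (C : 'M[R]_(e, d)) u,
    edge_mx w = C *m edge_mx v /\ w ord0 = simplex_chart v u.
Proof.
move=> wv; have /choice[t tE] : forall i, exists t, w i = simplex_chart v t.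
  by move=> i; exact/affine_span_range.
exists (\matrix_i (t (lift ord0 i) - t ord0)), (t ord0); split=> //.
apply/row_matrixP => i; rewrite row_mul !rowK !tE /simplex_chart mulmxBl.
by rewrite opprD addrACA subrr add0r.
Qed.

Lemma simplex_volumeM d N (v w : 'I_d.+1 -> 'rV[R]_N) (C : 'M[R]_d) :
  edge_mx w = C *m edge_mx v -> simplex_volume w = `|\det C| * simplex_volume v.
Proof.
move=> wE; rewrite /simplex_volume wE trmx_mul mulmxA -[C *m _ *m _]mulmxA.
by rewrite !det_mulmx det_tr [X in Num.sqrt X]mulrAC -expr2 sqrtrM ?sqr_ge0// sqrtr_sqr mulrA.
Qed.

Lemma simplex_volume_gt0 d N (v : 'I_d.+1 -> 'rV[R]_N) :
  affinely_independent v -> 0 < simplex_volume v.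
Proof.
by move=> vfree; rewrite divr_gt0 ?sqrtr_gt0 ?det_gram_gt0// ltr0n fact_gt0.
Qed.

Lemma affine_dim_le d e N (v : 'I_d.+1 -> 'rV[R]_N) (w : 'I_e.+1 -> 'rV[R]_N) :
  (forall i, affine_span (range v) (w i)) -> affinely_independent w -> (e <= d)%N.
Proof.
move=> /edge_mx_factor[C [_ [wE _]]]; rewrite /affinely_independent wE /row_free => /eqP <-.
by rewrite (leq_trans (mxrankM_maxl _ _))// rank_leq_col.
Qed.

Lemma factor_unitmx d N (C : 'M[R]_d) (E : 'M[R]_(d, N)) : row_free (C *m E) -> C \in unitmx.
Proof.
rewrite -row_free_unit /row_free => /eqP CE.
by rewrite eqn_leq rank_leq_row -[X in (X <= _)%N]CE mxrankM_maxl.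
Qed.

(** The coordinates [f] read off coefficients in the basis of edges of [v]. An integer simplex thus
    has an invertible integer coefficient matrix, whose determinant has absolute value at least
    1. *)
Lemma smallest_integer_simplexI d N (v : 'I_d.+1 -> 'rV[R]_N) (f : 'I_d -> 'I_N) :
  (forall i j, v i ord0 j \is a Num.int) ->
  (forall i j, edge_mx v i (f j) = (i == j)%:R) ->
  affinely_independent v /\
  smallest_integer_simplex (affine_span (range v)) v.
Proof.
move=> vint vf.
have E1 m (C : 'M[R]_(m, d)) i j : (C *m edge_mx v) i (f j) = C i j.
  rewrite mxE (bigD1 j)//= vf eqxx mulr1 big1 ?addr0// => k kj.
  by rewrite vf (negbTE kj) mulr0.
have vfree : affinely_independent v.
  apply: inj_row_free => x /rowP xE; apply/rowP => j.
  by have := xE (f j); rewrite E1 !mxE.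
split=> //; split.
  by split=> // i; apply: sub_affine_span; exists i.
move=> w [wfree wv wint]; have [C [u [wE _]]] := edge_mx_factor wv.
rewrite (simplex_volumeM wE) ler_peMl ?(ltW (simplex_volume_gt0 _))//.
have Cint i j : C i j \is a Num.int.
  by rewrite -E1 -wE !mxE rpredB.
apply: norm_intr_ge1.
  by apply: rpred_sum => s _; rewrite rpredMsign rpred_prod.
by rewrite -unitfE -unitmxE; apply: factor_unitmx (edge_mx v) _; rewrite -wE.
Qed.

(** Any competing simplex has the same dimension, and by mutual minimality its chart differs from
    that of [v] by a translation and a matrix of determinant 1 or -1, which preserves
    [lebesgue_rV]. *)
Lemma normalized_volume_chart d N (P : set 'rV[R]_N) (v : 'I_d.+1 -> 'rV[R]_N) :
  affinely_independent v -> affine_span P = affine_span (range v) ->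
  smallest_integer_simplex (affine_span P) v ->
  rV_measurable (fun y => (\1_(simplex_chart v @^-1` P) y : R)%:E) ->
  normalized_volume P = ((d`!)%:R%:E * lebesgue_rV (simplex_chart v @^-1` P))%E.
Proof.
move=> vfree Pv vmin mP; rewrite /normalized_volume; apply: xget_unique.
  by exists d, v; split=> //; exists v.
move=> _ [d' [v' [[w [wfree Pw]] v'min ->]]].
have in_span e (x : 'I_e.+1 -> 'rV[R]_N) i : affine_span (range x) (x i).
  by apply: sub_affine_span; exists i.
have dd' : d' = d.
  apply/eqP; rewrite eqn_leq; apply/andP; split.
    by apply: (affine_dim_le (v := v) _ wfree) => i; rewrite -Pv -Pw.
  by apply: (affine_dim_le (v := w) _ vfree) => i; rewrite Pw Pv.
subst d'; case: (v'min) => -[v'free v'v v'int] v'le.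
have [C [u [v'E v'u]]] : exists (C : 'M[R]_d) u,
    edge_mx v' = C *m edge_mx v /\ v' ord0 = simplex_chart v u.
  by apply: edge_mx_factor => i; rewrite -Pv.
have uC : C \in unitmx by apply: (factor_unitmx (E := edge_mx v)); rewrite -v'E.
have C1 : `|\det C| = 1.
  have s0 := simplex_volume_gt0 vfree.
  have : simplex_volume v' = simplex_volume v.
    by apply/eqP; rewrite eq_le v'le ?(proj2 vmin)//; case: vmin.
  rewrite (simplex_volumeM v'E) => /(canRL (mulfK (lt0r_neq0 s0))) ->.
  by rewrite mulfV// gt_eqF.
congr (_ * _)%E; rewrite !lebesgue_rVE.
set S := simplex_chart v @^-1` P in mP *.
pose F y : \bar R := (\1_S y)%:E.
have F0 y : (0 <= F y)%E by rewrite lee_fin indicE ler0n.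
transitivity (integral_rV (fun y => F (y *m C + u))).
  apply: eq_integral_rV => y.
  rewrite -[LHS]/((\1_P (simplex_chart v' y))%:E) (_ : simplex_chart v' y = simplex_chart v (y *m C + u))//.
  by rewrite /simplex_chart v'u v'E /simplex_chart mulmxDl mulmxA addrA addrAC.
have mFu : rV_measurable (fun y => F (y + u)).
  have := rV_measurable_affine 1%:M u mP.
  by under [X in rV_measurable X]eq_fun do rewrite mulmx1.
rewrite (scales_volume_unitmx uC (F := fun y => F (y + u)))// C1 invr1 mul1e.
exact: integral_rV_shift.
Qed.

End NormalizedVolume.

(** * The chart of a spanning tree *)

Lemma measurable_all (I : Type) (l : seq I) d (T : measurableType d) (p : I -> T -> bool) :
  (forall i, measurable_fun setT (p i)) ->
  measurable_fun [set: T] (fun x => all (p^~ x) l).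
Proof.
move=> mp; elim: l => [|i l IH] /=; first exact: measurable_cst.
exact: measurable_and.
Qed.

Section ChartVolume.
Context (R : realType).

Definition flow_region n d (c : 'I_d -> nat * nat) (s : nat -> R) : set 'rV[R]_d :=
  [set t | (forall k, 0 <= t ord0 k) /\
    (forall i, (i < n)%N -> 0 <= s i - \sum_k t ord0 k * edge_col R (c k) i)].

Lemma lebesgue_rV_set0 d : lebesgue_rV (set0 : set 'rV[R]_d) = 0%E.
Proof.
elim: d => [|d IH] /=; first by rewrite indicE in_set0.
by apply: integral0_eq => x _; rewrite -[RHS]IH; congr lebesgue_rV.
Qed.

(** The slice of the region at first coordinate [x] is the region for the remaining edges with
    supplies [push_flow s x], and is empty for [x < 0]. *)
Lemma lebesgue_rV_flow_region n d (c : 'I_d -> nat * nat) s :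
  lebesgue_rV (flow_region n c s) = spline n [seq c k | k <- enum 'I_d] s.
Proof.
elim: d c s => [|d IH] c s.
  rewrite enum_ord0 /= indicE; congr (_%:R%:E); congr nat_of_bool.
  apply/asboolP/allP => [[_ H] i|H].
    by rewrite mem_iota add0n => /H; rewrite big_ord0 subr0.
  split=> [[]//|i i_n]; rewrite big_ord0 subr0; apply: H.
  by rewrite mem_iota.
rewrite enum_ordSl map_cons -map_comp.
apply: eq_integral => x _.
have rl (y : 'rV[R]_d) k : (row_mx x%:M y : 'rV[R]_(1 + d)) ord0 (lift ord0 k) = y ord0 k.
  by rewrite -(row_mxEr x%:M y); congr (row_mx _ _ _ _); apply: val_inj.
have r0 (y : 'rV[R]_d) : (row_mx x%:M y : 'rV[R]_(1 + d)) ord0 ord0 = x.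
  transitivity (row_mx x%:M y ord0 (lshift d ord0)); last by rewrite row_mxEl mxE eqxx.
  by congr (row_mx _ _ _ _); apply: val_inj.
case: ifP => x0; last first.
  apply: etrans (lebesgue_rV_set0 d); congr (@lebesgue_rV R d _).
  by apply/seteqP; split=> // y [/(_ ord0)]; rewrite r0 x0.
apply: etrans (IH (c \o lift ord0) _); congr (@lebesgue_rV R d _).
have sE (y : 'rV[R]_d) i : \sum_(k < d.+1) (row_mx x%:M y : 'rV[R]_(1 + d)) ord0 k * edge_col R (c k) i =
    x * edge_col R (c ord0) i + \sum_k y ord0 k * edge_col R (c (lift ord0 k)) i.
  by rewrite big_ord_recl r0; congr (_ + _); apply: eq_bigr => k _; rewrite rl.
apply/seteqP; split=> y [y0 ys]; split=> [k|i i_n].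
- by rewrite -rl.
- by rewrite /push_flow -addrA -opprD -sE; exact: ys.
- case: (unliftP ord0 k) => [j|] ->; first by rewrite rl.
  by rewrite r0.
- by rewrite sE opprD addrA; exact: ys.
Qed.

Lemma rV_measurable_flow_region n d (c : 'I_d -> nat * nat) s :
  rV_measurable (fun t => (\1_(flow_region n c s) t : R)%:E).
Proof.
move=> d1 T1 h g _ mg; apply/measurable_EFinP.
rewrite (_ : (fun x => _) = (fun x : T1 => (all (fun k => 0 <= g x ord0 k) (enum 'I_d) &&
   all (fun i => 0 <= s i - \sum_k g x ord0 k * edge_col R (c k) i) (iota 0 n))%:R)); last first.
  apply/funext => x; rewrite indicE; congr (_%:R); congr nat_of_bool.
  apply/asboolP/andP => -[H1 H2].
    split; apply/allP => i; first by move=> _; exact: H1.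
    by rewrite mem_iota add0n; exact: H2.
  split=> i; first by apply: (allP H1); rewrite mem_enum.
  by move=> i_n; apply: (allP H2); rewrite mem_iota.
apply: (@measurableT_comp _ _ _ _ _ _ (fun b : bool => b%:R : R)) => //.
apply: measurable_and; apply: measurable_all => i.
  by apply: measurable_fun_ler.
apply: measurable_fun_ler => //; apply: measurable_funB => //.
by apply: measurable_sum => k; exact: measurable_funM.
Qed.

Section SpanningTree.
Variables (n : nat) (G : multigraph n.+1) (tau : 'I_n -> 'I_(nb_edges G)).
Hypothesis tauE : forall i, edge (tau i) = (widen_ord (leqnSn n) i, ord_max).

Let N := nb_edges G.
Let P := @flow_polytope R n.+1 G (@netflow_ones n).

Definition nat_edge (e : 'I_N) : nat * nat := ((edge e).1 : nat, (edge e).2 : nat).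

Definition free_edges : {set 'I_N} := ~: [set tau i | i in 'I_n]%SET.
Let d := #|free_edges|.
Definition free_edge (k : 'I_d) : 'I_N := enum_val k.

Let tau_inj : injective tau.
Proof.
move=> i j ij; have := tauE i; rewrite ij tauE => -[/esym h]; exact: val_inj.
Qed.

Lemma big_tree_free (T : Type) (idx : T) (op : Monoid.com_law idx) (g : 'I_N -> T) :
  \big[op/idx]_e g e =
  op (\big[op/idx]_i g (tau i)) (\big[op/idx]_k g (free_edge k)).
Proof.
rewrite (bigID (mem [set tau i | i in 'I_n]%SET))/=; congr (op _ _).
  by rewrite big_imset//=; exact: in2W.
by rewrite -big_enum_val; apply: eq_bigl => e; rewrite !inE.
Qed.

Let nat_edge_tau i : nat_edge (tau i) = (i : nat, n).
Proof. by rewrite /nat_edge tauE. Qed.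

Let tree_or_free e : (exists i, e = tau i) \/ (exists k, e = free_edge k).
Proof.
have [/imsetP[i _ ->]|eF] := boolP (e \in [set tau i | i in 'I_n]%SET); [by left; exists i|right].
have eF' : e \in free_edges by rewrite inE.
by exists (enum_rank_in eF' e); rewrite /free_edge enum_rankK_in.
Qed.

Let free_neq_tau k i : (tau i == free_edge k) = false.
Proof.
apply/negP => /eqP E; have := enum_valP k; rewrite -/(free_edge k) -E inE.
by rewrite imset_f.
Qed.

Definition tree_flow (f : 'rV[R]_N) (i : 'I_n) : R :=
  1 - \sum_k f ord0 (free_edge k) * edge_col R (nat_edge (free_edge k)) i.

(** Each non-sink vertex meets exactly one tree edge, so conservation there solves for its flow. The
    equation at the sink follows because both the net outflows and the supplies sum to zero. *)
Lemma conservationP (f : 'rV[R]_N) :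
  (forall i : 'I_n.+1, \sum_(e | (edge e).2 == i) f ord0 e + (netflow_ones i)%:~R =
     \sum_(e | (edge e).1 == i) f ord0 e) <->
  (forall i : 'I_n, f ord0 (tau i) = tree_flow f i).
Proof.
pose D (i : 'I_n.+1) : R := \sum_e f ord0 e * edge_col R (nat_edge e) i.
have DE i : D i = \sum_(e | (edge e).1 == i) f ord0 e - \sum_(e | (edge e).2 == i) f ord0 e.
  rewrite [X in X - _]big_mkcond [X in _ - X]big_mkcond -sumrB; apply: eq_bigr => e _.
  rewrite /edge_col /nat_edge/= !val_eqE ![i == _]eq_sym mulrBr.
  by do 2 case: eqP => _; rewrite ?mulr1 ?mulr0.
have DtE (i : 'I_n) : D (widen_ord (leqnSn n) i) = f ord0 (tau i) +
    \sum_k f ord0 (free_edge k) * edge_col R (nat_edge (free_edge k)) i.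
  rewrite /D big_tree_free/=; congr (_ + _).
  rewrite (bigD1 i)//= big1 ?addr0 => [|j ji].
    by rewrite nat_edge_tau /edge_col/= eqxx (ltn_eqF (ltn_ord i)) subr0 mulr1.
  rewrite nat_edge_tau /edge_col/= (ltn_eqF (ltn_ord i)) subr0.
  by rewrite val_eqE eq_sym (negbTE ji) mulr0.
have netE (i : 'I_n) : netflow_ones (widen_ord (leqnSn n) i) = 1.
  by rewrite /netflow_ones -val_eqE/= (ltn_eqF (ltn_ord i)).
transitivity (forall i, D i = (netflow_ones i)%:~R).
  split=> H i; first by rewrite DE -H addrC addKr.
  by rewrite -H DE addrC subrK.
split=> H i.
  have := H (widen_ord (leqnSn n) i); rewrite netE DtE => h.
  by rewrite /tree_flow -[X in X - _]/(1%:~R) -h addrK.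
have Hi (j : 'I_n) : D (widen_ord (leqnSn n) j) = 1 by rewrite DtE H /tree_flow subrK.
have D0 : \sum_i D i = 0.
  rewrite exchange_big/= big1// => e _; rewrite -mulr_sumr.
  rewrite /edge_col sumrB.
  have s1 (j : 'I_n.+1) : \sum_(i < n.+1) ((i : nat) == (j : nat))%:R = 1 :> R.
    by rewrite (bigD1 j)//= eqxx big1 ?addr0// => k; rewrite -val_eqE/= => /negbTE ->.
  by rewrite !s1 subrr mulr0.
case: (unliftP ord_max i) => [j ->|->].
  have -> : lift ord_max j = widen_ord (leqnSn n) j by apply: val_inj; rewrite /= /bump leqNgt ltn_ord.
  by rewrite Hi netE.
move: D0; rewrite big_ord_recr/= (eq_bigr (fun=> 1)) => [|j _]; last by rewrite Hi.
rewrite sumr_const card_ord /netflow_ones eqxx => /eqP.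
by rewrite addrC addr_eq0 => /eqP ->; rewrite mulrNz.
Qed.

Definition base_flow : 'rV[R]_N := \row_e (e \in [set tau i | i in 'I_n]%SET)%:R.

(** Row [k] is the fundamental cycle of a free edge: a unit flow along it, compensated on the tree
    edges at its ends. *)
Definition cycle_mx : 'M[R]_(d, N) := \matrix_(k, e)
  if [pick i | tau i == e] is Some i then - edge_col R (nat_edge (free_edge k)) i
  else (e == free_edge k)%:R.

Definition tree_simplex (j : 'I_d.+1) : 'rV[R]_N :=
  base_flow + if unlift ord0 j is Some k then row k cycle_mx else 0.

Let cycle_mx_tau k i : cycle_mx k (tau i) = - edge_col R (nat_edge (free_edge k)) i.
Proof.
rewrite mxE; case: pickP => [j /eqP/tau_inj ->//|/(_ i)].
by rewrite eqxx.
Qed.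

Let cycle_mx_free k l : cycle_mx k (free_edge l) = (k == l)%:R.
Proof.
rewrite mxE; case: pickP => [j|_]; first by rewrite free_neq_tau.
by rewrite (inj_eq enum_val_inj) eq_sym.
Qed.

Lemma edge_mx_tree_simplex : edge_mx tree_simplex = cycle_mx.
Proof.
apply/row_matrixP => k; rewrite rowK /tree_simplex liftK unlift_none addr0.
by rewrite addrC addKr.
Qed.

Let chartE t : simplex_chart tree_simplex t = base_flow + t *m cycle_mx.
Proof. by rewrite /simplex_chart edge_mx_tree_simplex /tree_simplex unlift_none addr0. Qed.

Let chart_free t k : simplex_chart tree_simplex t ord0 (free_edge k) = t ord0 k.
Proof.
rewrite chartE mxE mxE; have := enum_valP k; rewrite -/(free_edge k) inE => /negbTE ->.
rewrite add0r mxE (bigD1 k)//= cycle_mx_free eqxx mulr1 big1 ?addr0// => l lk.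
by rewrite cycle_mx_free (negbTE lk) mulr0.
Qed.

Let chart_tau t i : simplex_chart tree_simplex t ord0 (tau i) =
  1 - \sum_k t ord0 k * edge_col R (nat_edge (free_edge k)) i.
Proof.
rewrite chartE mxE mxE imset_f// mxE -sumrN; congr (_ + _); apply: eq_bigr => k _.
by rewrite cycle_mx_tau mulrN.
Qed.

Let tree_flow_chart t i : tree_flow (simplex_chart tree_simplex t) i =
  simplex_chart tree_simplex t ord0 (tau i).
Proof.
rewrite chart_tau /tree_flow; congr (_ - _).
by apply: eq_bigr => k _; rewrite chart_free.
Qed.

Let tree_flow_inv (f : 'rV[R]_N) : (forall i, f ord0 (tau i) = tree_flow f i) ->
  f = simplex_chart tree_simplex (\row_k f ord0 (free_edge k)).
Proof.
move=> H; apply/rowP => e; case: (tree_or_free e) => [[i]|[k]] ->.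
  by rewrite H chart_tau; congr (_ - _); apply: eq_bigr => k _; rewrite mxE.
by rewrite chart_free mxE.
Qed.

Lemma chart_polytope :
  simplex_chart tree_simplex @^-1` P = flow_region n (nat_edge \o free_edge) (fun=> 1).
Proof.
apply/seteqP; split=> t.
  move=> [f0 _]; split=> [k|i i_n]; first by rewrite -chart_free.
  by rewrite -(chart_tau t (Ordinal i_n)).
move=> [t0 tn]; split; last by apply/conservationP => i; rewrite tree_flow_chart.
move=> e; case: (tree_or_free e) => [[i]|[k]] ->; last by rewrite chart_free.
by rewrite chart_tau; exact: tn.
Qed.

Let edge_col_le1 e i : edge_col R e i <= 1.
Proof.
by rewrite /edge_col; do 2 case: eqP => _ /=; lra.
Qed.

(** Conservation is affine, which gives one inclusion. For the other, a flow with all entries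
    positive lies in the polytope, and any [x] satisfying conservation is on a line through it and a
    second point of the polytope. *)
Lemma affine_span_polytope : affine_span P = affine_span (range tree_simplex).
Proof.
apply/seteqP; split=> x.
  move=> [k [c [p [pP c1 ->]]]]; apply/affine_span_range.
  exists (\row_k0 (\sum_i c i *: p i) ord0 (free_edge k0)); apply: tree_flow_inv => i.
  have H j : p j ord0 (tau i) = tree_flow (p j) i.
    by case: (pP j) => _ /conservationP.
  rewrite /tree_flow summxE -c1.
  under [X in _ - X]eq_bigr do rewrite summxE mulr_suml.
  rewrite exchange_big/= -sumrB; apply: eq_bigr => j _; rewrite mxE H /tree_flow.
  rewrite mulrBr mulr1 mulr_sumr; congr (_ - _).
  by apply: eq_bigr => l _; rewrite mxE mulrA.
move=> /affine_span_range[t xE].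
(* With [del] on each of the [d] free edges, every tree edge keeps at least [1 - d * del = del]. *)
pose del : R := d.+1%:R^-1.
have del0 : 0 < del by rewrite invr_gt0 ltr0n.
pose p := simplex_chart tree_simplex (const_mx del).
have pdel e : del <= p ord0 e.
  rewrite /p; case: (tree_or_free e) => [[i]|[k]] ->; last by rewrite chart_free mxE.
  rewrite chart_tau lerBrDr -lerBrDl.
  apply: (@le_trans _ _ (\sum_(k < d) del)).
    by apply: ler_sum => k _; rewrite mxE ler_piMr ?(ltW del0).
  rewrite sumr_const card_ord -mulr_natl lerBrDr -[X in _ + X]mul1r -mulrDl natr1.
  by rewrite /del mulfV ?pnatr_eq0.
(* [M] bounds every entry of [x - p], so a step of length [s = del / M] towards [x] changes no entry
   by more than [del]. *)
pose M := 1 + \sum_e `|x ord0 e - p ord0 e|.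
have M0 : 0 < M by rewrite ltr_wpDr// sumr_ge0.
pose s := del / M.
have s0 : 0 < s by rewrite divr_gt0.
pose q := simplex_chart tree_simplex ((1 - s) *: const_mx del + s *: t).
have qE : q = (1 - s) *: p + s *: x.
  rewrite /q /p xE !chartE mulmxDl -!scalemxAl !scalerDr addrACA -scalerDl subrK.
  by rewrite scale1r.
exists 2, (fun i : 'I_2 => if i == ord0 then 1 - s^-1 else s^-1),
  (fun i : 'I_2 => if i == ord0 then p else q); split.
- have PC u : (forall e, 0 <= simplex_chart tree_simplex u ord0 e) -> P (simplex_chart tree_simplex u).
    by move=> u0; split=> //; apply/conservationP => i; rewrite tree_flow_chart.
  move=> i; case: ifP => _; apply: PC => e.
    exact: le_trans (ltW del0) (pdel e).
  rewrite -/q qE mxE [X in X + _]mxE [X in _ + X]mxE.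
  rewrite mulrBl mul1r -addrA [- _ + _]addrC -mulrBr.
  rewrite -lerBlDr sub0r; apply: le_trans (pdel e).
  apply: (@le_trans _ _ (s * `|x ord0 e - p ord0 e|)).
    by rewrite -mulrN ler_wpM2l ?(ltW s0)// -normrN ler_norm.
  rewrite /s mulrAC ler_pdivrMr// ler_wpM2l ?(ltW del0)//.
  by rewrite /M (bigD1 e)//= addrCA lerDl addr_ge0// sumr_ge0.
- by rewrite big_ord_recl big_ord1/= subrK.
- rewrite big_ord_recl big_ord1/= qE [X in _ + X]scalerDr !scalerA mulrBr mulr1 mulVf ?gt_eqF//.
  by rewrite scale1r addrA -scalerDl addrA subrK subrr scale0r add0r.
Qed.

Lemma normalized_volume_tree : normalized_volume P =
  (d`!%:R%:E * spline n [seq nat_edge (free_edge k) | k <- enum 'I_d] (fun=> 1%R))%E.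
Proof.
have [|k l|vfree vmin] := @smallest_integer_simplexI R d N tree_simplex free_edge.
- move=> i e; rewrite mxE rpredD ?mxE ?natr_int//.
  case: unlift => [k|]; last by rewrite mxE rpred0.
  rewrite mxE; case: (tree_or_free e) => [[j]|[l]] ->.
    by rewrite cycle_mx_tau rpredN rpredB// natr_int.
  by rewrite cycle_mx_free natr_int.
- by rewrite edge_mx_tree_simplex cycle_mx_free.
rewrite (normalized_volume_chart vfree affine_span_polytope).
- by rewrite chart_polytope lebesgue_rV_flow_region.
- by rewrite affine_span_polytope.
- by rewrite chart_polytope; exact: rV_measurable_flow_region.
Qed.

End SpanningTree.
End ChartVolume.

(** * The graph K^{a,b} *)

Section KabVolume.
Context (R : realType).

Lemma size_multi_list n a m :
  size (multi_list n (fun e => if e.2 == n then m else a)) = (m * n + a * 'C(n, 2))%N.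
Proof.
apply/eqP; rewrite -(eqr_nat R) -sum1_size natr_sum big_multi_list.
under eq_bigr do rewrite mulr1.
rewrite big_edge_list/= [X in _ + X](eq_bigr (fun=> m%:R)) => [|i _]; last by rewrite eqxx.
rewrite sumr_const card_ord.
rewrite [X in X + _](_ : _ = a%:R * ((n * n.-1)%:R / 2)); last first.
  transitivity (a%:R * \sum_(i < n) \sum_(j < n | (i < j)%N)
      ((i \in [set: 'I_n]%SET) && (j \in [set: 'I_n]%SET))%:R : R).
    rewrite mulr_sumr; apply: eq_bigr => i _; rewrite mulr_sumr.
    by apply: eq_bigr => j _; rewrite (ltn_eqF (ltn_ord j)) !inE mulr1.
  by rewrite sum_pairs_in cardsT card_ord.
rewrite addrC natrD !natrM -[_ *+ n]mulr_natr.
apply/eqP; congr (_ + _ * _); apply: (@mulfI _ 2%:R); rewrite ?pnatr_eq0//.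
rewrite [LHS]mulrC divfK ?pnatr_eq0// -!natrM; congr _%:R.
by have := mul_bin_diag n 1; rewrite bin1.
Qed.

Let nat_pair n (e : 'I_n.+1 * 'I_n.+1) : nat * nat := (e.1 : nat, e.2 : nat).

Let nat_pair_inj n : injective (@nat_pair n).
Proof. by move=> [i j] [k l] [/val_inj -> /val_inj ->]. Qed.

Lemma count_Kab_edges n a b (e : nat * nat) :
  count_mem e [seq nat_pair x | x <- Kab_edges n a b] =
  if is_edge n e then (if e.2 == n then b else a) else 0%N.
Proof.
case: ifP => [/andP[e12 e2n]|en].
  have e1n : (e.1 < n.+1)%N by rewrite ltnS (leq_trans (ltnW e12)).
  pose x := (Ordinal e1n, Ordinal (e2n : (e.2 < n.+1)%N)).
  rewrite (_ : e = nat_pair x); last by rewrite /nat_pair/= -surjective_pairing.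
  rewrite count_map (eq_count (a2 := pred1 x)) => [|y]; last by rewrite /= (inj_eq (@nat_pair_inj n)).
  rewrite /Kab_edges count_flatten_nseq; last by apply: filter_uniq; exact: enum_uniq.
  by rewrite mem_filter mem_enum /= e12 -val_eqE.
apply/eqP; rewrite -leqn0 leqNgt -has_count has_pred1; apply/negP => /mapP[x xK xe].
have := allP (Kab_edges_increasing n a b) _ xK.
by move: en; rewrite xe /is_edge/= leq_ord andbT => ->.
Qed.

Lemma nb_edges_map n (G : multigraph n.+1) :
  [seq nat_pair x | x <- edges G] = [seq nat_edge e | e <- enum 'I_(nb_edges G)].
Proof.
have := congr1 (map (@nat_pair n)) (map_tnth_enum (in_tuple (edges G))).
by rewrite -map_comp => /esym.
Qed.

(** The tree uses one of the [m.+1] sink edges at each vertex; the free edges have multiplicities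
    [m] and [a], and their number is the dimension. *)
Lemma normalized_volume_Kab n a m :
  normalized_volume (@flow_polytope R n.+1 (Kab n a m.+1) (@netflow_ones n)) =
  ((m * n + a * 'C(n, 2))`!%:R *
   flow_volume R n (fun e => if e.2 == n then m else a))%:E.
Proof.
set G := Kab n a m.+1.
have /choice[tau tauE] : forall i : 'I_n, exists e : 'I_(nb_edges G),
    edge e = (widen_ord (leqnSn n) i, ord_max).
  move=> i; have : (widen_ord (leqnSn n) i, ord_max) \in Kab_edges n a m.+1.
    have := count_Kab_edges n a m.+1 (i : nat, n).
    rewrite /is_edge/= ltn_ord leqnn eqxx => h.
    have : (i : nat, n) \in [seq nat_pair x | x <- Kab_edges n a m.+1].
      by rewrite -has_pred1 has_count h.
    case/mapP => -[x y] xK [ix ny].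
    by rewrite (_ : (_, _) = (x, y))//; congr (_, _); apply: val_inj.
  by move=> /(tnthP (in_tuple _))[e ->]; exists e.
rewrite (normalized_volume_tree R tauE).
set X := [seq _ | k <- _].
have XP : perm_eq X (multi_list n (fun e => if e.2 == n then m else a)).
  apply: eq_count_perm => e; rewrite count_multi_list.
  have := count_Kab_edges n a m.+1 e; rewrite -[Kab_edges _ _ _]/(edges G) nb_edges_map.
  rewrite count_map -sum1_count big_enum_cond/= big_mkcond/=.
  rewrite (big_tree_free tauE)/=.
  rewrite /X count_map -sum1_count big_enum_cond/= [in X in _ -> X = _]big_mkcond/=.
  set S := (X in (X + _)%N); set T := (X in (_ + X)%N).
  have -> : S = (is_edge n e && (e.2 == n))%N.
    rewrite /S.
    have E (i : 'I_n) : (nat_edge (tau i) == e) = (e == (i : nat, n)).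
      by rewrite /nat_edge tauE eq_sym.
    rewrite (eq_bigr (fun i : 'I_n => nat_of_bool (e == (i : nat, n)))) => [|i _]; last first.
      by rewrite /= E; case: eqP.
    have [en|] := boolP (is_edge n e && (e.2 == n)).
      case/andP: en => /andP[e12 _] /eqP e2; have e1n : (e.1 < n)%N by rewrite -e2.
      rewrite (bigD1 (Ordinal e1n))//= -{1}e2 -surjective_pairing eqxx big1// => i.
      rewrite -val_eqE/= => ie; case: eqP => // h; move: ie.
      by rewrite h eqxx.
    move=> en; rewrite big1// => i _; case: eqP => // h; move: en.
    by rewrite h /is_edge/= ltn_ord leqnn eqxx.
  case: is_edge => //=; case: eqP => _ /=; lia.
have XE : all (is_edge n) X by rewrite (perm_all _ XP) multi_list_edges.
rewrite (perm_spline _ XP) -[spline _ _ _]fineK ?spline_fin_num ?multi_list_edges//.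
rewrite -EFinM; congr (_`!%:R * _)%:E.
by rewrite -(size_multi_list n a m) -(perm_size XP) size_map size_enum_ord.
Qed.

(** No edge enters the sink, which demands [n] units: the polytope is empty, has no dimension, and
    [xget] returns its default. *)
Lemma normalized_volume_Kab0 n a : (0 < n)%N ->
  normalized_volume (@flow_polytope R n.+1 (Kab n a 0) (@netflow_ones n)) = 0%E.
Proof.
move=> n0; rewrite (_ : flow_polytope _ = set0).
  apply: xgetPN => x [d [v [[w [_ wE]] _ _]]].
  have : affine_span (set0 : set 'rV[R]_(nb_edges (Kab n a 0))) (w ord0).
    by rewrite -wE; apply: sub_affine_span; exists ord0.
  case=> -[|k] [c [p [p0 c1 _]]]; last by have := p0 ord0.
  by move: c1; rewrite big_ord0 => /eqP; rewrite eq_sym oner_eq0.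
apply/seteqP; split=> // f [f0 /(_ ord_max)].
rewrite [X in X + _]big1 ?add0r => [|e /eqP e2]; last first.
  have : edge e \in Kab_edges n a 0 by exact: mem_tnth.
  case/flattenP => s /mapP[x _ ->]; rewrite mem_nseq => /andP[+ /eqP xE].
  by rewrite -xE e2 eqxx.
move=> h; have : 0 <= - n%:R :> R.
  by move: h; rewrite /netflow_ones eqxx mulrNz => ->; exact: sumr_ge0.
by rewrite oppr_ge0 lern0 => /eqP n_0; rewrite n_0 in n0.
Qed.

Definition gamma_product n a (x : R) : R :=
  \prod_(0 <= i < n) (Gamma (1 + a%:R / 2 : R) /
    (Gamma (1 + (i + 1)%:R * a%:R / 2) * Gamma (x + i%:R * a%:R / 2))).

Lemma gamma_productS n a (x : R) : 1 <= x ->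
  gamma_product n a x =
  (\prod_(u < n) (x + a%:R * u%:R / 2)) * gamma_product n a (x + 1).
Proof.
move=> x1; rewrite /gamma_product !big_mkord -big_split/=; apply: eq_bigr => i _.
have y1 : 1 <= x + i%:R * a%:R / 2.
  by rewrite (le_trans x1)// lerDl !mulr_ge0.
rewrite [x + 1 + _]addrAC (GammaS y1) [a%:R * i%:R]mulrC.
have y0 : x + i%:R * a%:R / 2 != 0 by rewrite gt_eqF// (lt_le_trans ltr01).
rewrite [RHS]mulrCA; congr (_ * _); rewrite !invfM [RHS]mulrCA; congr (_ * _).
by rewrite mulVKf.
Qed.

(** With [g i] the value of Gamma at [1 + i a / 2], both sides are products of [g 1 / (g (i+1) g i)]
    and of [g 1 / (g (i+1) g (i+2))]; shifting indices leaves only [g 0 = 1]. *)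
Lemma gamma_product_contract n a : gamma_product n.+1 a 1 = gamma_product n a (1 + a%:R).
Proof.
have G0 (x : R) : 0 <= x -> Gamma (1 + x) != 0.
  by move=> x0; rewrite gt_eqF// Gamma_gt0// lerDl.
have ia0 (i : nat) : 0 <= i%:R * a%:R / 2 :> R by rewrite !mulr_ge0.
pose g (i : nat) : R := Gamma (1 + i%:R * a%:R / 2).
have g0 i : g i != 0 by exact: G0.
have gS : \prod_(0 <= i < n.+1) g i = g 0%N * \prod_(0 <= i < n) g i.+1.
  by rewrite big_nat_recl.
have gR : \prod_(0 <= i < n) g i.+2 * g 1%N = \prod_(0 <= i < n.+1) g i.+1.
  by rewrite [RHS]big_nat_recl// mulrC.
have E1 : Gamma (1 + a%:R / 2 : R) = g 1%N by rewrite /g mul1r.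
have P0 (f : nat -> nat) k : \prod_(0 <= i < k) g (f i) != 0.
  by rewrite big_mkord; apply/prodf_neq0 => i _; exact: g0.
rewrite /gamma_product.
rewrite (eq_bigr (fun i => g 1%N / (g i.+1 * g i))) => [|i _]; last by rewrite E1 addn1.
rewrite [RHS](eq_bigr (fun i => g 1%N / (g i.+1 * g i.+2))) => [|i _]; last first.
  rewrite E1 addn1; congr (_ / (_ * _)); rewrite /g; congr Gamma.
  by rewrite -natr1 -natr1; field.
rewrite !big_split/= !prodfV !big_split/= gS -gR big_nat_recr//=.
have g00 : g 0%N = 1 by rewrite /g !mul0r addr0 Gamma1.
rewrite g00 mul1r.
have := P0 (fun i => i.+1) n; have := P0 (fun i => i.+2) n.
move: (\prod_(0 <= i < n) g i.+2) (\prod_(0 <= i < n) g i.+1) => p q q0 p0.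
have := g0 1%N; move: (g 1%N) (\prod_(0 <= i < n) _) => z w z0.
by field; rewrite q0 p0 z0.
Qed.

(** Induction on [n], then on [m]: contraction settles [m = 0] from the case [n - 1] with [m = a],
    and the step to [m.+1] divides by the nonzero product common to both recurrences. *)
Lemma flow_volumeE n a m :
  flow_volume R n (fun e => if e.2 == n then m else a) = gamma_product n a m.+1%:R.
Proof.
elim: n m => [|n IHn] m; first by rewrite flow_volume0 /gamma_product big_nil.
have step k : flow_volume R n.+1 (fun e => if e.2 == n.+1 then k else a) =
    gamma_product n.+1 a k.+1%:R ->
    flow_volume R n.+1 (fun e => if e.2 == n.+1 then k.+1 else a) =
    gamma_product n.+1 a k.+2%:R.
  rewrite flow_volume_sink_step gamma_productS ?ler1n// natr1 => /mulfI; apply.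
  by apply/prodf_neq0 => u _; rewrite gt_eqF// ltr_wpDr ?ltr0n.
elim: m => [|m IHm]; last exact: step.
by rewrite flow_volume_contract IHn gamma_product_contract -natr1 addrC.
Qed.

End KabVolume.

(* For b = 0 the polytope is empty and the right-hand side is 0, since         *)
(* (Gamma 0)^-1 = 0; the truncated subtraction is an honest one for b >= 1.    *)
Theorem theorem1p3 (R : realType) (n a b : nat) (hn : (2 <= n)%N) :
  normalized_volume (@flow_polytope R n.+1 (Kab n a b) (@netflow_ones n)) =
  (((b * n + a * 'C(n, 2) - n)`!)%:R *
   \prod_(0 <= i < n)
     (Gamma (1 + a%:R / 2 : R) /
      (Gamma (1 + (i + 1)%:R * a%:R / 2) * Gamma (b%:R + i%:R * a%:R / 2))))%:E.
Proof.
case: b => [|m].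
  rewrite normalized_volume_Kab0 ?(ltnW hn)//; case: n hn => // n _.
  by rewrite big_nat_recl// mul0r mul0r addr0 Gamma0 mulr0 invr0 mulr0 mul0r mulr0.
rewrite normalized_volume_Kab flow_volumeE /gamma_product.
by rewrite mulSn -addnA addKn.
Qed.
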